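(* (The independence threshold is not the right criterion under correlation.) Under conditional independence of the gates, gating helps if and only if the mean likelihood ratio exceeds one (a threshold dichotomy at $\Lambda^\star=1$). Under correlation, $\bar\Lambda=\bar\beta/\bar\alpha>1$ guarantees only that the first gate helps ($\delta_1=\ln\bar\Lambda>0$); the eventual direction is decided by the tail exponents $b_\alpha$ versus $b_\beta$, which are logically independent of $\bar\Lambda$. An example with $\bar\Lambda=2.2$ and $r_k\to0$ is given by $p_0=0.5$, $\alpha\sim\mathrm{Beta}(0.7,1.63)$ and $\beta\sim\mathrm{Beta}(8,4)$ (so $\bar\alpha=0.3$, $\bar\beta=0.67$, to the precision given).
   Context: A candidate answer is correct with prior probability $p_0$ and is passed through $k$ verification gates; it is returned only if all $k$ accept. If it is erroneous, it carries a latent false-accept rate $\alpha\sim G$ on $[0,1]$, given which the gate verdicts are i.i.d., each accepting with probability $\alpha$; if it is correct, it carries a latent true-accept rate $\beta\sim H$ on $[0,1]$, given which the verdicts are i.i.d., each accepting with probability $\beta$. The means are $\bar\alpha=\mathbb{E}_G[\alpha]$, $\bar\beta=\mathbb{E}_H[\beta]$. The conditionally independent case is the one where $\alpha,\beta$ are constants, with likelihood ratio $\Lambda=\beta/\alpha$ per gate. $r_k$ is the probability that the answer is correct given that all $k$ gates accept, $\ell_k=\ln\frac{r_k}{1-r_k}=\ell_0+\ln\mathbb{E}_H[\beta^k]-\ln\mathbb{E}_G[\alpha^k]$ with $\ell_0=\ln\frac{p_0}{1-p_0}$, and $\delta_1=\ell_1-\ell_0$ is the net evidence of the first gate. The tail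 exponents: $G$ and $H$ have no atoms at $1$ and have densities $\sim c_\alpha(1-x)^{b_\alpha-1}$ and $\sim c_\beta(1-x)^{b_\beta-1}$ respectively as $x\uparrow1$. The eventual direction is: $\ell_k\to+\infty$ if $b_\alpha>b_\beta$ (gates eventually always help), plateau of $r_k$ at a limit below $1$ if $b_\alpha=b_\beta$, and $\ell_k\to-\infty$, $r_k\to0$ if $b_\alpha<b_\beta$ (gates eventually harm). *)

(* Defs.v *)
From HB Require Import structures.
From mathcomp Require Import all_boot all_order all_algebra.
From mathcomp Require Import all_classical all_reals all_analysis.

Set Implicit Arguments.
Unset Strict Implicit.
Unset Printing Implicit Defensive.

Import Order.TTheory GRing.Theory Num.Theory.
Import numFieldNormedType.Exports.

Local Open Scope classical_set_scope.
Local Open Scope ring_scope.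

Notation latent_law R := (probability (measurableTypeR R) R).

Section gates.
Context {R : realType}.

Definition on_unit (G : latent_law R) : Prop := G `[0, 1]%classic = 1%E.

Definition constant_law (a : R) : latent_law R :=
  @dirac _ (measurableTypeR R) a R.

Definition mean (G : latent_law R) : R := \int[G]_x x.

Definition mean_LR (G H : latent_law R) : R := mean H / mean G.

(* Verdict vectors of k gates: [v i] says that gate i accepts. *)
Definition verdicts (k : nat) : finType := {ffun 'I_k -> bool}.

(* Probability of the verdict vector v when, given the latent rate x, the
   verdicts are i.i.d. and each accepts with probability x. *)
Definition verdicts_given (k : nat) (x : R) (v : verdicts k) : R :=
  \prod_(i < k) (if v i then x else 1 - x).

(* Joint law of (correctness, verdicts), the latent rate being integrated out:
   G is the law of the rate of an erroneous answer, H that of a correct one. *)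
Definition joint_pmf (p0 : R) (G H : latent_law R) (k : nat)
    (w : (bool * verdicts k)%type) : R :=
  if w.1 then p0 * \int[H]_x verdicts_given x w.2
  else (1 - p0) * \int[G]_x verdicts_given x w.2.

Definition joint_prob (p0 : R) (G H : latent_law R) (k : nat)
    (E : {set bool * verdicts k}) : R :=
  \sum_(w in E) joint_pmf p0 G H w.

Definition correct (k : nat) : {set bool * verdicts k} :=
  [set w | w.1]%SET.

Definition all_accept (k : nat) : {set bool * verdicts k} :=
  [set w | [forall i, (w.2 : verdicts k) i]]%SET.

(* r_k *)
Definition reliability (p0 : R) (G H : latent_law R) (k : nat) : R :=
  joint_prob p0 G H (correct k :&: all_accept k)%SET
    / joint_prob p0 G H (all_accept k).

Definition logit (p : R) : R := ln (p / (1 - p)).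

(* ell_k *)
Definition log_odds (p0 : R) (G H : latent_law R) (k : nat) : R :=
  logit (reliability p0 G H k).

(* delta_1 *)
Definition first_gate_evidence (p0 : R) (G H : latent_law R) : R :=
  log_odds p0 G H 1 - logit p0.

(* G has no atom at 1 and, on some interval ]1 - e, 1[, a density f with
   f x ~ c (1 - x)^(b - 1) as x tends to 1 from below. *)
Definition tail_exponent (G : latent_law R) (b : R) : Prop :=
  G [set 1] = 0%E /\
  exists (c e : R) (f : R -> R),
    [/\ 0 < b, 0 < c /\ 0 < e, measurable_fun `]1 - e, 1[%classic f,
        (forall x, x \in `]1 - e, 1[ -> 0 <= f x) &
        (forall B : set (measurableTypeR R), measurable B ->
           B `<=` `]1 - e, 1[%classic ->
           G B = (\int[lebesgue_measure]_(x in B) (f x)%:E)%E)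
        /\ f x / (1 - x) `^ (b - 1) @[x --> 1^'-] --> c].

(* Beta laws with real parameters (the library's beta_prob has natural ones). *)
Definition rbeta_kernel (a b x : R) : R := x `^ (a - 1) * (1 - x) `^ (b - 1).

Definition rbeta_fun (a b : R) : R :=
  \int[lebesgue_measure]_(x in `]0, 1[%classic) rbeta_kernel a b x.

Definition is_beta_law (a b : R) (G : latent_law R) : Prop :=
  forall B : set (measurableTypeR R), measurable B ->
    G B = (\int[lebesgue_measure]_(x in B `&` `]0%R, 1%R[%classic)
             (rbeta_kernel a b x / rbeta_fun a b)%:E)%E.

End gates.

(* Main.v *)
(* Only the behaviour of a law at 1 matters for its high moments: if G has a
   density f with f x ~ c (1 - x)^(b - 1) at 1, then E[x^k (1 - x)^j] is
   equivalent to c B(k + 1, b + j), since the part of either integral away from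
   1 is O(t^k) for some t < 1, whereas B(k + 1, b + j) decays polynomially.
   With j = 0 this compares the moments of G and H.  With j = 0 and j = 1, and
   B(k + 1, b + 1) = b / (k + 1 + b) B(k + 1, b), it gives
   1 - E[x^(k+1)] / E[x^k] ~ b / k, hence the eventual monotonicity of the log-odds.
   The recurrences of the Beta function replace the Gamma function throughout.
   Beta laws of prescribed second parameter b and prescribed mean in ]0, 1[
   have tail exponent b and show that the exponents are independent of the mean
   ratio. *)
Require Import Defs.
From HB Require Import structures.
From mathcomp Require Import all_boot all_order all_algebra.
From mathcomp Require Import all_classical all_reals all_analysis.
From mathcomp Require Import measurable_realfun ring lra.
Set Implicit Arguments.
Unset Strict Implicit.
Unset Printing Implicit Defensive.
Import Order.TTheory GRing.Theory Num.Theory.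
Import numFieldNormedType.Exports.
Local Open Scope classical_set_scope.
Local Open Scope ring_scope.

Import HBNNSimple.

(** The density is controlled only by a limit at 1, so the moments have no exact formula. The
    central estimate is therefore uniform in k: given eps, a cut t < 1 chosen before k bounds the
    error by eps B(k + 1, b + j) + C t^k. Comparing two exponents b' < b also requires B(k + 1, b) /
    B(k + 1, b') to tend to 0; allowing the tail constant c to vanish makes this an instance of the
    same estimate. A limit of the moment ratio says nothing about its monotonicity, which is why the
    factor 1 - x is needed besides the plain moments. Since the reliability depends on the two laws
    only through the ratio of their k-th moments, the helpful and the harmful direction are one
    statement about moments with the laws exchanged. *)

(** * Integration against a measure with a density on a set *)

(** Monotone convergence along simple functions increasing to [g] reduces both sides to indicators
    of level sets, where the hypothesis on [nu] applies. That hypothesis concerns subsets of [D]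
    only, so it suits a law whose density is known only near 1. *)
Lemma ge0_integral_density (d : measure_display) (T : measurableType d)
    (R : realType) (mu nu : {measure set T -> \bar R}) (D : set T)
    (f : T -> R) (g : T -> \bar R) :
  measurable D -> measurable_fun D f -> (forall x, D x -> 0 <= f x) ->
  (forall B, measurable B -> B `<=` D ->
     nu B = (\int[mu]_(x in B) (f x)%:E)%E) ->
  measurable_fun D g -> (forall x, D x -> (0 <= g x)%E) ->
  (\int[nu]_(x in D) g x = \int[mu]_(x in D) (g x * (f x)%:E))%E.
Proof.
move=> mD mf f0 nuE mg g0.
pose h := nnsfun_approx mD mg.
have mfE : measurable_fun D (EFin \o f) by exact/measurable_EFinP.
have -> : (\int[nu]_(x in D) g x =
    lim (\int[nu]_(x in D) (EFin \o h n) x @[n --> \oo]))%E.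
  have gE x : D x -> g x = lim ((EFin \o h n) x @[n --> \oo]).
    by move=> Dx; apply/esym/cvg_lim => //; exact: cvg_nnsfun_approx.
  under eq_integral => x /[!inE] /gE -> //.
  apply: monotone_convergence => //.
  - move=> n; apply/measurable_EFinP.
    by apply: (measurable_funS measurableT) => //; exact/measurable_funP.
  - by move=> n x Dx //=; rewrite lee_fin.
  - by move=> x Dx a b ab; rewrite lee_fin; exact/lefP/nd_nnsfun_approx.
have -> : (\int[mu]_(x in D) (g x * (f x)%:E) =
    lim (\int[mu]_(x in D) ((h n x)%:E * (f x)%:E) @[n --> \oo]))%E.
  have gf x : D x ->
      (g x * (f x)%:E)%E = lim (((h n x)%:E * (f x)%:E)%E @[n --> \oo]).
    by move=> Dx; apply/esym/cvg_lim => //; apply: cvgeZr => //;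
      exact: cvg_nnsfun_approx.
  under eq_integral => x /[!inE] /gf -> //.
  apply: monotone_convergence => //.
  - move=> n; apply: emeasurable_funM => //; apply: measurable_funTS.
    exact/measurable_EFinP.
  - by move=> n x Dx; rewrite mule_ge0 ?lee_fin ?f0.
  - move=> x Dx a b ab /=; rewrite lee_wpmul2r ?lee_fin ?f0//.
    exact/lefP/nd_nnsfun_approx.
suff suf n : (\int[mu]_(x in D) ((h n x)%:E * (f x)%:E) =
    \int[nu]_(x in D) (EFin \o h n) x)%E.
  by under [in RHS]eq_fun do rewrite suf.
have indich r : measurable_fun D (fun x => (r * \1_(h n @^-1` [set r]) x)%:E).
  by apply: (measurable_comp measurableT) => //; exact: measurable_funM.
transitivity (\int[nu]_(x in D)
   (\sum_(y \in range (h n)) (y * \1_(h n @^-1` [set y]) x)%:E))%E; last first.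
  by apply: eq_integral => t tD; rewrite /= fimfunE -fsumEFin.
rewrite ge0_integral_fsum//; last by move=> y x Dx; exact: nnfun_muleindic_ge0.
transitivity (\int[mu]_(x in D) (\sum_(y \in range (h n))
    (y * \1_(h n @^-1` [set y]) x)%:E * (f x)%:E))%E.
  apply: eq_integral => x xD; rewrite -ge0_mule_fsuml => [|y].
    by rewrite fsumEFin// -(fimfunE _ x).
  exact: nnfun_muleindic_ge0.
rewrite ge0_integral_fsum//; last 2 first.
  - by move=> y; exact: emeasurable_funM.
  - move=> y x Dx; rewrite mule_ge0 ?lee_fin ?f0//.
    exact: nnfun_muleindic_ge0.
apply: eq_fsbigr => r rh.
under eq_integral do rewrite EFinM -muleA.
have mA : measurable (h n @^-1` [set r]) by exact: measurable_sfunP.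
have r0 : 0 <= r by move: rh; rewrite inE => -[x _ <-].
rewrite integralZl_indic_nnsfun// ge0_integralZl//; last first.
- by move=> x Dx; rewrite mule_ge0 ?lee_fin ?f0.
- by apply: emeasurable_funM => //; exact/measurable_EFinP.
congr (_ * _)%E; rewrite integral_indic// setIC nuE; last 2 first.
- exact: measurableI.
- exact: subIsetl.
rewrite integral_mkcondr; apply: eq_integral => x _.
rewrite patchE indicE; case: ifPn => _; first by rewrite mul1e.
by rewrite mul0e.
Qed.

(** * Real powers and the Beta kernel *)

Lemma powR_continuous_at (R : realType) (p x : R) :
  0 < x -> {for x, continuous (@powR R ^~ p)}.
Proof.
move=> x0; apply: differentiable_continuous; apply/derivable1_diffP.
by apply: derivable_powR; rewrite in_itv/= x0.
Qed.

Lemma onem_powR_continuous_at (R : realType) (p x : R) :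
  x < 1 -> {for x, continuous (fun y : R => (1 - y) `^ p)}.
Proof.
move=> x1; apply: (@continuous_comp R R R (fun y : R => 1 - y) (@powR R ^~ p)).
  by apply: cvgB; [exact: cvg_cst|exact: cvg_id].
by apply: powR_continuous_at; rewrite subr_gt0.
Qed.

Lemma is_derive_onem_powR (R : realType) (p x : R) : x < 1 ->
  is_derive x 1 (fun y : R => (1 - y) `^ p) (- (p * (1 - x) `^ (p - 1))).
Proof.
move=> x1.
have x10 : 0 < 1 - x by rewrite subr_gt0.
have h1 : is_derive x 1 (fun y : R => 1 - y) (- 1).
  have := is_deriveB (is_derive_cst (1 : R) x 1) (is_derive_id x 1).
  by rewrite sub0r.
have h2 : is_derive (1 - x) 1 (@powR R ^~ p) (p * (1 - x) `^ (p - 1)).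
  split; first by apply: derivable_powR; rewrite in_itv/= x10.
  by rewrite -derive1E powR_derive1// in_itv/= x10.
have := @is_derive1_comp R (@powR R ^~ p) (fun y => 1 - y) x _ _ h2 h1.
by rewrite mulrN1.
Qed.

Lemma powR_le1 (R : realType) (x p : R) : 0 <= x <= 1 -> 0 <= p -> x `^ p <= 1.
Proof.
move=> /andP[x0 x1] p0.
by have := ge0_ler_powR p0 x0 (@ler01 R) x1; rewrite powR1.
Qed.

Lemma rbeta_kernel_ge0 (R : realType) (a b x : R) : 0 <= rbeta_kernel a b x.
Proof. by rewrite mulr_ge0 ?powR_ge0. Qed.

Lemma rbeta_kernel_gt0 (R : realType) (a b x : R) :
  0 < x < 1 -> 0 < rbeta_kernel a b x.
Proof. by move=> /andP[x0 x1]; rewrite mulr_gt0 ?powR_gt0 ?subr_gt0. Qed.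

Lemma measurable_rbeta_kernel (R : realType) (a b : R) (D : set R) :
  measurable_fun D (rbeta_kernel a b).
Proof.
apply: measurable_funTS; apply: measurable_funM; first exact: measurable_powR.
apply: (@measurableT_comp _ _ _ _ _ _ (@powR R ^~ (b - 1))).
  exact: measurable_powR.
exact: measurable_funB.
Qed.

(* Unlike rbeta_fun, which is 0 when the integral diverges, this keeps +oo, so
   that the recurrences can be stated before finiteness is known. *)
Definition erbeta (R : realType) (a b : R) : \bar R :=
  (\int[lebesgue_measure]_(x in `]0%R, 1%R[%classic)
     (rbeta_kernel a b x)%:E)%E.

Lemma erbeta_ge0 (R : realType) (a b : R) : (0 <= erbeta a b)%E.
Proof. by apply: integral_ge0 => x _; rewrite lee_fin rbeta_kernel_ge0. Qed.

(** * The Beta integral: recurrences, finiteness, positivity *)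

(** The two kernels are, up to the factors a and -b, the terms of the derivative of x^a (1 - x)^b.
    On a segment inside ]0, 1[ they are continuous whatever the signs of a and b. *)
Lemma rbeta_kernel_parts (R : realType) (a b u v : R) : 0 < u -> u < v -> v < 1 ->
  (a%:E * \int[lebesgue_measure]_(x in `[u, v]) (rbeta_kernel a (b + 1) x)%:E =
   b%:E * \int[lebesgue_measure]_(x in `[u, v]) (rbeta_kernel (a + 1) b x)%:E
   + (v `^ a * (1 - v) `^ b - u `^ a * (1 - u) `^ b)%:E)%E.
Proof.
move=> u0 uv v1.
have uvP x : `[u, v]%classic x -> 0 < x /\ x < 1.
  by rewrite /= in_itv/= => /andP[ux xv]; split;
    [exact: lt_le_trans ux|exact: le_lt_trans v1].
have cK c d : {within `[u, v], continuous (rbeta_kernel c d)}.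
  apply: continuous_in_subspaceT => x /set_mem/uvP[x0 x1].
  by apply: cvgM; [exact: powR_continuous_at|exact: onem_powR_continuous_at].
have iK c d : lebesgue_measure.-integrable `[u, v]%classic
    (EFin \o rbeta_kernel c d).
  by apply: continuous_compact_integrable => //; exact: segment_compact.
pose f (x : R) := a * x `^ (a - 1).
pose g (x : R) := - (b * (1 - x) `^ (b - 1)).
have LR (F : R -> R) : (forall x, 0 < x -> x < 1 -> derivable F x 1) ->
    derivable_oo_LRcontinuous F u v.
  move=> dF.
  have cF x : 0 < x -> x < 1 -> {for x, continuous F}.
    by move=> x0 x1; apply: differentiable_continuous; apply/derivable1_diffP;
      exact: dF.
  split.
  - by move=> x /subset_itv_oo_cc/uvP[]; exact: dF.
  - by apply: cvg_at_right_filter; apply: cF => //; exact: lt_trans v1.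
  - by apply: cvg_at_left_filter; apply: cF => //; exact: lt_trans uv.
have cf : {within `[u, v], continuous f}.
  apply: continuous_in_subspaceT => x /set_mem/uvP[x0 x1].
  by apply: cvgM; [exact: cvg_cst|exact: powR_continuous_at].
have cg : {within `[u, v], continuous g}.
  apply: continuous_in_subspaceT => x /set_mem/uvP[x0 x1].
  by apply: cvgN; apply: cvgM;
    [exact: cvg_cst|exact: onem_powR_continuous_at].
have dF : derivable_oo_LRcontinuous (@powR R ^~ a) u v.
  by apply: LR => x x0 x1; apply: derivable_powR; rewrite in_itv/= x0.
have dG : derivable_oo_LRcontinuous (fun x : R => (1 - x) `^ b) u v.
  by apply: LR => x x0 x1; have [] := is_derive_onem_powR b x1.
have Ff : {in `]u, v[, (@powR R ^~ a)^`()%classic =1 f}.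
  by move=> x /subset_itv_oo_cc/uvP[x0 _]; rewrite powR_derive1// in_itv/= x0.
have Gg : {in `]u, v[, (fun x : R => (1 - x) `^ b)^`()%classic =1 g}.
  by move=> x /subset_itv_oo_cc/uvP[_ x1]; rewrite derive1E;
    have [_ ->] := is_derive_onem_powR b x1.
have := integration_by_parts uv cf dF Ff cg dG Gg.
under eq_integral => x /set_mem/uvP[x0 x1].
  have -> : x `^ a * g x = (- b) * rbeta_kernel (a + 1) b x.
    by rewrite /g /rbeta_kernel addrK; ring.
  rewrite EFinM; over.
rewrite integralZl//=; last exact: iK.
under [X in (_ - X)%E]eq_integral => x /set_mem/uvP[x0 x1].
  have -> : f x * (1 - x) `^ b = a * rbeta_kernel a (b + 1) x.
    by rewrite /f /rbeta_kernel addrK; ring.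
  rewrite EFinM; over.
rewrite integralZl//=; last exact: iK.
have fK c d : (\int[lebesgue_measure]_(x in `[u, v])
    (rbeta_kernel c d x)%:E)%E \is a fin_num.
  by apply: integrable_fin_num => //; exact: iK.
rewrite -(fineK (fK (a + 1) b)) -(fineK (fK a (b + 1))).
rewrite -!EFinM -EFinB -EFinD => -[h]; congr (_%:E).
set A := (v `^ a * _ - _) in h *.
by move: h; rewrite mulNr => /eqP; rewrite eqr_oppLR => /eqP ->; ring.
Qed.

(** The segments [u n, 1 - u n] exhaust ]0, 1[; monotone convergence of the nonnegative kernels
    holds even if a limit is infinite, and the boundary terms vanish because a and b are
    positive. *)
Lemma erbeta_parts (R : realType) (a b : R) : 0 < a -> 0 < b ->
  (a%:E * erbeta a (b + 1) = b%:E * erbeta (a + 1) b)%E.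
Proof.
move=> a0 b0.
(* Starting at 1/3 keeps u n < 1/2, so that every segment is nondegenerate. *)
pose u (n : nat) : R := n.+3%:R^-1.
have u0 n : 0 < u n by rewrite invr_gt0.
have u2 n : u n < 2^-1 by rewrite ltf_pV2 ?posrE// ltr_nat.
pose F n := `[u n, 1 - u n]%classic.
have FU : `]0%R, 1%R[%classic = \bigcup_n F n.
  apply/seteqP; split=> x.
    rewrite /= in_itv/= => /andP[x0 x1].
    have m0 : 0 < Num.min x (1 - x) by rewrite lt_min x0 subr_gt0.
    have [k] := ltr_add_invr m0; rewrite add0r lt_min => /andP[kx k1x].
    exists k => //; rewrite /F /= in_itv/= lerBrDl.
    have uk : u k <= k.+1%:R^-1 by rewrite lef_pV2 ?posrE// ler_nat ltnW.
    rewrite (le_trans uk (ltW kx))/= addrC -lerBrDl.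
    exact: le_trans uk (ltW k1x).
  move=> [n _]; rewrite /F /= !in_itv/= => /andP[ux xu].
  by rewrite (lt_le_trans (u0 n) ux) (le_lt_trans xu)// ltrBlDl ltrDr.
have ndF : nondecreasing_seq F.
  move=> m n mn; apply/subsetPset => x; rewrite /F /= !in_itv/= => /andP[h1 h2].
  have unm : u n <= u m by rewrite lef_pV2 ?posrE// ler_nat !ltnS.
  by rewrite (le_trans unm h1)/= (le_trans h2)// lerD2l lerN2.
have cvgI c d : (\int[lebesgue_measure]_(x in F n) (rbeta_kernel c d x)%:E
    @[n --> \oo] --> erbeta c d)%E.
  rewrite /erbeta FU; apply: ge0_nondecreasing_set_cvg_integral => //.
  - by move=> i; exact: measurable_itv.
  - by move=> i; apply/measurable_EFinP; exact: measurable_rbeta_kernel.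
  - by move=> i x _; rewrite lee_fin rbeta_kernel_ge0.
have u_cvg : u n @[n --> \oo] --> (0 : R).
  have h := @cvg_harmonic R; rewrite -(cvg_shiftn 2) in h.
  have -> : u = (fun n => harmonic (n + 2)%N).
    by apply/funext => n; rewrite /u /harmonic /= addn2.
  exact: h.
pose phi n : R := (1 - u n) `^ a * (1 - (1 - u n)) `^ b
  - u n `^ a * (1 - u n) `^ b.
have phi0 : phi n @[n --> \oo] --> (0 : R).
  have c1 c : 0 < c -> u n `^ c @[n --> \oo] --> (0 : R).
    by move=> /powR_cvg0/cvg_at_rightP; apply.
  have c2 c : (1 - u n) `^ c @[n --> \oo] --> (1 : R).
    have h : (1 - y) `^ c @[y --> (0 : R)] --> (1 - 0 : R) `^ c.
      exact: onem_powR_continuous_at ltr01.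
    rewrite subr0 powR1 in h.
    exact: (cvg_comp _ _ u_cvg h).
  rewrite (_ : 0 = 1 * 0 - 0 * 1 :> R); last by rewrite mulr0 mul0r subrr.
  apply: cvgB; apply: cvgM => //; try exact: c1; try exact: c2.
  by under eq_fun do rewrite subKr; exact: c1.
have e : (a%:E * \int[lebesgue_measure]_(x in F n) (rbeta_kernel a (b + 1) x)%:E)%E
  @[n --> \oo] --> (b%:E * erbeta (a + 1) b)%E.
  rewrite -[X in _ --> X]adde0.
  have h : ((b%:E * \int[lebesgue_measure]_(x in F n) (rbeta_kernel (a + 1) b x)%:E
     + (phi n)%:E)%E @[n --> \oo] --> (b%:E * erbeta (a + 1) b + 0%:E)%E).
    apply: cvgeD.
    - by rewrite fin_num_adde_defl.
    - by apply: cvgeZl => //; exact: cvgI.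
    - by apply: cvg_EFin; [exact: nearW|exact: phi0].
  apply: cvg_trans h; apply: near_eq_cvg; apply: nearW => n.
  rewrite /F rbeta_kernel_parts//; last 2 first.
  - by have := u2 n; lra.
  - by rewrite ltrBlDl ltrDr.
apply: cvg_unique e; first exact: ereal_hausdorff.
by apply: cvgeZl => //; exact: cvgI.
Qed.

(** Multiply the kernel by x + (1 - x) = 1. *)
Lemma erbetaD (R : realType) (a b : R) :
  erbeta a b = (erbeta (a + 1) b + erbeta a (b + 1))%E.
Proof.
rewrite /erbeta -ge0_integralD//; last 4 first.
- by move=> x _; rewrite lee_fin rbeta_kernel_ge0.
- by apply/measurable_EFinP; exact: measurable_rbeta_kernel.
- by move=> x _; rewrite lee_fin rbeta_kernel_ge0.
- by apply/measurable_EFinP; exact: measurable_rbeta_kernel.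
apply: eq_integral => x; rewrite inE/= in_itv/= => /andP[x0 x1].
rewrite -EFinD /rbeta_kernel !addrK; congr _%:E.
rewrite powRB; last by apply/implyP => _; rewrite gt_eqF.
rewrite powRB; last by apply/implyP => _; rewrite subr_eq0 gt_eqF.
rewrite powRr1 ?ltW// powRr1 ?subr_ge0 ?ltW//; field.
by rewrite gt_eqF//= subr_eq0 gt_eqF.
Qed.

(* The recurrence reduces finiteness to exponents a + 1 and b + 1, for which the
   kernel is bounded by 1. *)
Lemma erbeta_lty (R : realType) (a b : R) : 0 < a -> 0 < b ->
  (erbeta a b < +oo)%E.
Proof.
move=> a0 b0.
have mul_lty (c : R) (x : \bar R) : 0 < c -> (0 <= x)%E ->
    (c%:E * x < +oo)%E -> (x < +oo)%E.
  by move=> c0; case: x => [r _ _|_|//]; rewrite ?ltry// gt0_muley.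
have h0 : (erbeta (a + 1) (b + 1) < +oo)%E.
  apply: (@le_lt_trans _ _ (\int[lebesgue_measure]_(x in `]0%R, 1%R[%classic)
      (cst 1 x))%E).
    apply: ge0_le_integral => //=.
    - by move=> x _; rewrite lee_fin rbeta_kernel_ge0.
    - by apply/measurable_EFinP; exact: measurable_rbeta_kernel.
    - move=> x; rewrite in_itv/= => /andP[x0 x1].
      rewrite lee_fin /rbeta_kernel !addrK.
      rewrite mulr_ile1 ?powR_ge0 ?powR_le1 ?(ltW a0) ?(ltW b0)//.
        by rewrite !ltW.
      by rewrite subr_ge0 gerBl !ltW.
  by rewrite integral_cst//= mul1e lebesgue_measure_itv/= lte_fin ltr01 -EFinB ltry.
(* Each parameter is lowered in turn: [erbetaD] splits the integral into a finite one and one that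
   [erbeta_parts] identifies as a multiple of it. *)
have h1 : (erbeta (a + 1) b < +oo)%E.
  rewrite erbetaD lte_add_pinfty//.
  apply: (mul_lty b) => //; first exact: erbeta_ge0.
  rewrite -erbeta_parts// ?addr_gt0//.
  by rewrite lte_mul_pinfty// lee_fin addr_ge0// ltW.
rewrite erbetaD lte_add_pinfty//.
apply: (mul_lty a) => //; first exact: erbeta_ge0.
by rewrite erbeta_parts// lte_mul_pinfty// lee_fin ltW.
Qed.

(** The kernel is positive on all of ]0, 1[; a zero integral would place this interval of length 1
    inside a null set. *)
Lemma erbeta_gt0 (R : realType) (a b : R) : (0 < erbeta a b)%E.
Proof.
rewrite lt_neqAle erbeta_ge0 andbT; apply/eqP => /esym h.
have : ae_eq lebesgue_measure `]0%R, 1%R[%classic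
    (fun x => (rbeta_kernel a b x)%:E) (cst 0%E).
  apply/ae_eq_integral_abs => //.
    by apply/measurable_EFinP; exact: measurable_rbeta_kernel.
  rewrite -[RHS]h; apply: eq_integral => x _.
  by rewrite gee0_abs// lee_fin rbeta_kernel_ge0.
move=> [N [mN N0 sN]].
have : (lebesgue_measure (`]0%R, 1%R[%classic : set R) <= lebesgue_measure N)%E.
  apply: le_measure; rewrite ?inE// => x x01.
  have := x01; rewrite /= in_itv/= => /(rbeta_kernel_gt0 a b) K0.
  by apply: sN => /= /(_ x01) -[] /eqP; rewrite gt_eqF.
by rewrite N0 lebesgue_measure_itv/= lte_fin ltr01 -EFinB lee_fin subr0 ler10.
Qed.

Lemma rbeta_funE (R : realType) (a b : R) : 0 < a -> 0 < b ->
  erbeta a b = (rbeta_fun a b)%:E.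
Proof.
move=> a0 b0; rewrite /rbeta_fun /Rintegral fineK//.
by rewrite ge0_fin_numE ?erbeta_lty// erbeta_ge0.
Qed.

Lemma rbeta_fun_gt0 (R : realType) (a b : R) : 0 < a -> 0 < b ->
  0 < rbeta_fun a b.
Proof. by move=> a0 b0; rewrite -lte_fin -rbeta_funE// erbeta_gt0. Qed.

(** [erbetaD] and [erbeta_parts] are two linear equations in the two shifted values; this solves
    them. *)
Lemma rbeta_funSl (R : realType) (a b : R) : 0 < a -> 0 < b ->
  rbeta_fun (a + 1) b = a / (a + b) * rbeta_fun a b.
Proof.
move=> a0 b0; have := @erbetaD _ a b; have := erbeta_parts a0 b0.
rewrite !rbeta_funE ?addr_gt0// -!EFinM -EFinD => -[h1] [->].
have ab0 : a + b != 0 by rewrite gt_eqF// addr_gt0.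
apply: (mulfI ab0); rewrite mulrA mulrCA mulfV// mulr1 mulrDr h1; ring.
Qed.

Lemma rbeta_funSr (R : realType) (a b : R) : 0 < a -> 0 < b ->
  rbeta_fun a (b + 1) = b / (a + b) * rbeta_fun a b.
Proof.
move=> a0 b0; have := erbeta_parts a0 b0.
rewrite !rbeta_funE ?addr_gt0// -!EFinM rbeta_funSl// => -[h1].
have ab0 : a + b != 0 by rewrite gt_eqF// addr_gt0.
by apply: (mulfI (lt0r_neq0 a0)); rewrite h1; field.
Qed.

(** * Beta laws: existence, support and moments *)

Lemma Rintegral_full_measure (d : measure_display) (T : measurableType d)
    (R : realType) (P : probability T R) (D : set T) (f : T -> R) :
  measurable D -> P D = 1%E -> measurable_fun setT f ->
  \int[P]_x f x = \int[P]_(x in D) f x.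
Proof.
move=> mD PD mf; rewrite /Rintegral [in RHS]integral_mkcond; congr fine.
have mfE : measurable_fun setT (EFin \o f) by exact/measurable_EFinP.
apply: ae_eq_integral => //.
  by apply/(measurable_restrictT _ _).1 => //; exact: measurable_funTS.
exists (~` D); split; first exact: measurableC.
  by rewrite [LHS]probability_setC// PD subee.
move=> x /= nfx Dx; apply: nfx => _.
by rewrite patchE mem_set.
Qed.

Section rbeta_measure.
Context {R : realType} (a b : R).

Definition rbeta_measure (U : set (measurableTypeR R)) : \bar R :=
  (\int[lebesgue_measure]_(x in U `&` `]0%R, 1%R[%classic)
     (rbeta_kernel a b x / rbeta_fun a b)%:E)%E.

Let rbeta_measure0 : rbeta_measure set0 = 0%E.
Proof. by rewrite /rbeta_measure set0I integral_set0. Qed.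

Let pdf_ge0 (x : R) : 0 <= rbeta_kernel a b x / rbeta_fun a b.
Proof.
rewrite mulr_ge0 ?rbeta_kernel_ge0// invr_ge0.
by apply: Rintegral_ge0 => y _; exact: rbeta_kernel_ge0.
Qed.

Let rbeta_measure_ge0 U : (0 <= rbeta_measure U)%E.
Proof. by apply: integral_ge0 => x _; rewrite lee_fin pdf_ge0. Qed.

Let rbeta_measure_sigma_additive : semi_sigma_additive rbeta_measure.
Proof.
move=> F mF tF mUF; rewrite /rbeta_measure; apply: cvg_toP.
  apply: ereal_nondecreasing_is_cvgn => m n mn.
  by apply: lee_sum_nneg_natr => // k _ _; exact: rbeta_measure_ge0.
rewrite setI_bigcupl ge0_integral_bigcup//=.
- by move=> n; apply: measurableI => //; exact: mF.
- apply/measurable_EFinP; apply: measurable_funM => //.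
  exact: measurable_rbeta_kernel.
- by move=> x _; rewrite lee_fin pdf_ge0.
- by apply: trivIset_setIr.
Qed.

HB.instance Definition _ := isMeasure.Build _ _ _ rbeta_measure
  rbeta_measure0 rbeta_measure_ge0 rbeta_measure_sigma_additive.

End rbeta_measure.

Lemma integral_rbeta_pdf (R : realType) (a b : R) : 0 < a -> 0 < b ->
  (\int[lebesgue_measure]_(x in `]0%R, 1%R[%classic)
     (rbeta_kernel a b x / rbeta_fun a b)%:E = 1)%E.
Proof.
move=> a0 b0; under eq_integral do rewrite EFinM.
rewrite ge0_integralZr//.
- by rewrite -/(erbeta a b) rbeta_funE// -EFinM mulfV// gt_eqF// rbeta_fun_gt0.
- by apply/measurable_EFinP; exact: measurable_rbeta_kernel.
- by move=> x _; rewrite lee_fin rbeta_kernel_ge0.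
- by rewrite lee_fin invr_ge0 ltW// rbeta_fun_gt0.
Qed.

(** [rbeta_measure] is a measure for all parameters but has mass one only under 0 < a and 0 < b.
    Normalizing always returns a probability, with [P] as default for a degenerate mass, and here it
    changes nothing. *)
Lemma mnormalize_prob (d : measure_display) (T : measurableType d)
    (R : realType) (m : {measure set T -> \bar R}) (P : probability T R) :
  m setT = 1%E -> mnormalize m P = m :> (set T -> \bar R).
Proof.
move=> m1; apply/funext => B.
by rewrite /mnormalize/= m1 onee_eq0/= invr1 mule1.
Qed.

Lemma beta_law_exists (R : realType) (a b : R) : 0 < a -> 0 < b ->
  exists G : latent_law R, is_beta_law a b G.
Proof.
move=> a0 b0.
have T1 : rbeta_measure a b setT = 1%E.
  by rewrite /rbeta_measure setTI integral_rbeta_pdf.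
exists (mnormalize (rbeta_measure a b) (constant_law 0)) => B mB.
exact: (congr1 (fun h => h B) (mnormalize_prob (constant_law 0) T1)).
Qed.

Section beta_law.
Context {R : realType} (a b : R) (G : latent_law R).
Hypotheses (a0 : 0 < a) (b0 : 0 < b) (GE : is_beta_law a b G).

Lemma beta_law_oo : G `]0, 1[%classic = 1%E.
Proof. by rewrite GE// setIid integral_rbeta_pdf. Qed.

Lemma beta_law_on_unit : on_unit G.
Proof.
rewrite /on_unit GE//; set I := `]0%R, 1%R[%classic; set J := `[0, 1]%classic.
have -> : J `&` I = I by apply/setIidr; exact: subset_itv_oo_cc.
by rewrite integral_rbeta_pdf.
Qed.

(** The factor x^k merely raises the first parameter of the kernel to a + k. *)
Lemma beta_law_moment (k : nat) :
  \int[G]_x (x ^+ k) = rbeta_fun (a + k%:R) b / rbeta_fun a b.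
Proof.
have mX : measurable_fun setT (fun x : measurableTypeR R => x ^+ k).
  exact: measurable_funX.
rewrite (Rintegral_full_measure _ beta_law_oo)//.
rewrite /Rintegral.
rewrite (@ge0_integral_density _ _ _ lebesgue_measure _ _
  (fun x => rbeta_kernel a b x / rbeta_fun a b))//; last 5 first.
- by apply: measurable_funM => //; exact: measurable_rbeta_kernel.
- by move=> x _; rewrite mulr_ge0 ?rbeta_kernel_ge0// invr_ge0 ltW// rbeta_fun_gt0.
- by move=> B mB BI; have := GE mB; rewrite (setIidl BI).
- by apply/measurable_EFinP; exact: measurable_funTS.
- by move=> x; rewrite /= in_itv/= => /andP[x0 _]; rewrite lee_fin exprn_ge0 ?ltW.
have -> : (\int[lebesgue_measure]_(x in `]0%R, 1%R[%classic)
    ((x ^+ k)%:E * (rbeta_kernel a b x / rbeta_fun a b)%:E) =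
    \int[lebesgue_measure]_(x in `]0%R, 1%R[%classic)
    ((rbeta_kernel (a + k%:R) b x)%:E * (rbeta_fun a b)^-1%:E))%E.
  apply: eq_integral => x; rewrite inE/= in_itv/= => /andP[x0 x1].
  rewrite -!EFinM mulrA; congr (_ * _)%:E.
  rewrite /rbeta_kernel mulrA; congr (_ * _).
  rewrite addrAC [in RHS]powRD; last by apply/implyP => _; rewrite gt_eqF.
  by rewrite powR_mulrn ?ltW// mulrC.
have ak0 : 0 < a + k%:R by rewrite ltr_wpDr.
rewrite ge0_integralZr//; last 3 first.
- by apply/measurable_EFinP; exact: measurable_rbeta_kernel.
- by move=> x _; rewrite lee_fin rbeta_kernel_ge0.
- by rewrite lee_fin invr_ge0 ltW// rbeta_fun_gt0.
by rewrite -/(erbeta _ _) rbeta_funE.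
Qed.

Lemma beta_law_mean : mean G = a / (a + b).
Proof.
rewrite /mean; have := beta_law_moment 1; rewrite /= => ->.
rewrite rbeta_funSl// mulfK// gt_eqF//.
exact: rbeta_fun_gt0.
Qed.

End beta_law.

(** * Asymptotics of moments from the density near 1 *)

(** By the recurrence, consecutive terms have quotient t (k + 1 + b) / (k + 1), which tends to t and
    hence is eventually below the midpoint s of t and 1. *)
Lemma geometric_rbeta_cvg0 (R : realType) (t b : R) : 0 < t < 1 -> 0 < b ->
  t ^+ k / rbeta_fun k.+1%:R b @[k --> \oo] --> (0 : R).
Proof.
move=> /andP[t0 t1] b0.
pose q k := t ^+ k / rbeta_fun k.+1%:R b.
have B0 k : 0 < rbeta_fun k.+1%:R b by exact: rbeta_fun_gt0.
have q0 k : 0 <= q k by rewrite mulr_ge0 ?exprn_ge0 ?invr_ge0 ?ltW.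
have qS k : q k.+1 = t * (k.+1%:R + b) / k.+1%:R * q k.
  have k0 : k.+1%:R != 0 :> R by rewrite gt_eqF.
  have kb0 : k.+1%:R + b != 0 by rewrite gt_eqF// addr_gt0.
  rewrite /q exprS -[in LHS]natr1 rbeta_funSl//; field.
  by rewrite addrC natr1 k0 kb0 gt_eqF.
pose s := (1 + t) / 2.
have s01 : 0 < s < 1 by rewrite /s; lra.
(* The quotient is at most s exactly when 2 t b is at most (1 - t) (k + 1). *)
have [N NP] : exists N : nat, 2 * t * b / (1 - t) <= N%:R.
  by exists (Num.bound (2 * t * b / (1 - t))); apply/ltW/archi_boundP;
    rewrite divr_ge0 ?mulr_ge0 ?subr_ge0 ?ltW.
have ratio k : (N <= k)%N -> q k.+1 <= s * q k.
  move=> Nk; rewrite qS ler_wpM2r// ler_pdivrMr//.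
  have kN : N%:R <= k%:R :> R by rewrite ler_nat.
  move: NP; rewrite ler_pdivrMr ?subr_gt0// => NP.
  have : N%:R * (1 - t) <= k%:R * (1 - t) by rewrite ler_wpM2r// subr_ge0 ltW.
  rewrite /s -natr1; nra.
have geo n : q (n + N)%N <= s ^+ n * q N.
  elim: n => [|n IH]; first by rewrite add0n expr0 mul1r.
  rewrite addSn (le_trans (ratio _ (leq_addl _ _)))// exprS -mulrA.
  by rewrite ler_wpM2l// ltW// (andP s01).1.
rewrite -(cvg_shiftn N) /=.
apply: (@squeeze_cvgr _ _ _ _ (fun=> 0) (fun n => s ^+ n * q N)).
- by apply: nearW => n; rewrite q0 geo.
- exact: cvg_cst.
- rewrite -(mul0r (q N)); apply: cvgM; last exact: cvg_cst.
  by apply: cvg_expr; rewrite ger0_norm ?(andP s01).2// ltW// (andP s01).1.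
Qed.

(* As tail_exponent, except that the constant c may vanish. *)
Definition tail_density {R : realType} (G : latent_law R) (b c : R) : Prop :=
  G [set 1] = 0%E /\
  exists (e : R) (f : R -> R),
    [/\ 0 < e, measurable_fun `]1 - e, 1[%classic f,
        (forall x, x \in `]1 - e, 1[ -> 0 <= f x),
        (forall B : set (measurableTypeR R), measurable B ->
           B `<=` `]1 - e, 1[%classic ->
           G B = (\int[lebesgue_measure]_(x in B) (f x)%:E)%E) &
        f x / (1 - x) `^ (b - 1) @[x --> 1^'-] --> c].

(* For b' < b the constant is 0, which makes Beta integrals with different
   second parameters comparable through moment_cvg. *)
Lemma beta_law_tail_density (R : realType) (a b b' : R) (G : latent_law R) :
  0 < a -> 0 < b -> is_beta_law a b G -> b' <= b ->
  tail_density G b' ((b == b')%:R / rbeta_fun a b).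
Proof.
move=> a0 b0 GE b'b; split.
  rewrite GE// (_ : _ `&` _ = set0) ?integral_set0//.
  by apply/seteqP; split => // x [/= ->]; rewrite in_itv/= ltxx andbF.
exists 1, (fun x => rbeta_kernel a b x / rbeta_fun a b); rewrite subrr; split.
- exact: ltr01.
- by apply: measurable_funM => //; exact: measurable_rbeta_kernel.
- move=> x _; rewrite mulr_ge0 ?rbeta_kernel_ge0// invr_ge0 ltW//.
  exact: rbeta_fun_gt0.
- by move=> B mB BI; have := GE B mB; rewrite (setIidl BI).
have h1 : x `^ (a - 1) @[x --> (1 : R)^'-] --> (1 : R).
  apply: cvg_at_left_filter.
  have h : y `^ (a - 1) @[y --> (1 : R)] --> (1 : R) `^ (a - 1).
    exact: powR_continuous_at ltr01.
  by rewrite powR1 in h.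
(* This factor decides the constant: it is 1 near the endpoint if b = b' and tends to 0 if b' <
   b. *)
have h2 : (1 - x) `^ (b - b') @[x --> (1 : R)^'-] --> ((b == b')%:R : R).
  have [->|bb'] := eqVneq b b'.
    rewrite subrr; under eq_fun do rewrite powRr0.
    exact: cvg_cst.
  have d0 : 0 < b - b' by rewrite subr_gt0 lt_neqAle eq_sym bb'.
  have /cvg_at_rightP h := powR_cvg0 d0.
  apply/cvg_at_leftP => u [u1 ucvg]; apply: (h (fun n => 1 - u n)); split.
    by move=> n; rewrite subr_gt0.
  by rewrite -(subrr 1); apply: cvgB => //; exact: cvg_cst.
have h : x `^ (a - 1) * (1 - x) `^ (b - b') / rbeta_fun a b @[x --> (1 : R)^'-]
    --> 1 * (b == b')%:R / rbeta_fun a b.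
  by apply: cvgM; [exact: cvgM|exact: cvg_cst].
rewrite mul1r in h; apply: cvg_trans h; apply: near_eq_cvg.
near=> x.
have x1 : 0 < 1 - x by rewrite subr_gt0; near: x; exact: nbhs_left_lt.
rewrite /rbeta_kernel [RHS]mulrAC; congr (_ / _).
rewrite -mulrA; congr (_ * _).
rewrite -powRB; last by apply/implyP => _; rewrite gt_eqF.
by congr (_ `^ _); ring.
Unshelve. all: by end_near. Qed.

Lemma on_unit_co (R : realType) (G : latent_law R) :
  on_unit G -> G [set 1] = 0%E -> G `[0, 1[%classic = 1%E.
Proof.
move=> GU G1; rewrite -[RHS]GU.
have -> : `[0, 1]%classic = `[0, 1[%classic `|` [set 1] :> set R.
  by rewrite setUitv1// bnd_simp.
rewrite [RHS]measureU//=; last first.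
  by rewrite -subset0 => x [/= + x1]; rewrite x1 in_itv/= ltxx andbF.
by rewrite G1 adde0.
Qed.

(** Here [e] is the part of the moment on ]t, 1[ and [m] that of the Beta integral: x^k (1 - x)^j
    turns the weight (1 - x)^(b - 1) into the kernel with parameters k + 1 and b + j. The rest of
    the Beta integral is controlled by x^k <= t^k on ]0, t]. The lower bound is written without c -
    eps, so that only nonnegative integrands occur. *)
Lemma tail_moment_bounds (R : realType) (f : R -> R) (t b c eps : R)
    (j k : nat) : 0 < t < 1 -> 0 < b -> 0 <= c -> 0 < eps ->
  measurable_fun `]t, 1[%classic f ->
  (forall x, t < x < 1 -> 0 <= f x) ->
  (forall x, t < x < 1 -> `|f x / (1 - x) `^ (b - 1) - c| <= eps) ->
  exists e m : R,
    [/\ (\int[lebesgue_measure]_(x in `]t, 1%R[%classic)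
          ((x ^+ k * (1 - x) ^+ j)%:E * (f x)%:E) = e%:E)%E,
        0 <= m, c * m <= e + eps * m, e <= (c + eps) * m &
        m <= rbeta_fun k.+1%:R (b + j%:R) <=
          t ^+ k * rbeta_fun 1 (b + j%:R) + m].
Proof.
move=> /andP[t0 t1] b0 c0 eps0 mf f0 fc.
have bj0 : 0 < b + j%:R by rewrite ltr_wpDr.
pose w (x : R) := (1 - x) `^ (b - 1).
pose h (x : R) := x ^+ k * (1 - x) ^+ j.
have mh : measurable_fun setT h.
  by apply: measurable_funM; apply: measurable_funX => //; exact: measurable_funB.
have mw : measurable_fun setT w.
  apply: (@measurableT_comp _ _ _ _ _ _ (@powR R ^~ (b - 1))).
    exact: measurable_powR.
  exact: measurable_funB.
have mhw (D : set R) : measurable_fun D (fun x => (h x * w x)%:E).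
  by apply/measurable_EFinP; apply: measurable_funTS; exact: measurable_funM.
have w0 x : x < 1 -> 0 < w x by move=> x1; rewrite powR_gt0 ?subr_gt0.
have h0 x : 0 < x -> x < 1 -> 0 <= h x.
  by move=> x0 x1; rewrite mulr_ge0 ?exprn_ge0 ?subr_ge0 ?ltW.
have hw0 x : 0 < x -> x < 1 -> (0 <= (h x * w x)%:E)%E.
  by move=> x0 x1; rewrite lee_fin mulr_ge0 ?h0// ltW ?w0.
have hwK x : 0 < x -> x < 1 -> h x * w x = rbeta_kernel k.+1%:R (b + j%:R) x.
  move=> x0 x1; rewrite /h /w /rbeta_kernel -natr1 addrK powR_mulrn ?ltW//.
  rewrite -mulrA; congr (_ * _).
  rewrite [in RHS]addrAC [in RHS]powRD; last first.
    by apply/implyP => _; rewrite subr_eq0 gt_eqF.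
  by rewrite powR_mulrn ?subr_ge0 ?ltW// mulrC.
pose D : set R := `]t, 1[%classic.
have mD : measurable (D : set (measurableTypeR R)) by exact: measurable_itv.
have DP x : D x -> t < x < 1 by rewrite /D /= in_itv.
have DP0 x : D x -> 0 < x < 1.
  by move=> /DP/andP[tx ->]; rewrite (lt_trans t0 tx).
set m2 := (\int[lebesgue_measure]_(x in D) (h x * w x)%:E)%E.
set m1 := (\int[lebesgue_measure]_(x in `]0%R, t]%classic) (h x * w x)%:E)%E.
set e2 := (\int[lebesgue_measure]_(x in D) ((h x)%:E * (f x)%:E))%E.
have mE : (rbeta_fun k.+1%:R (b + j%:R))%:E = (m1 + m2)%E.
  rewrite -rbeta_funE// /m1 /m2 /D -ge0_integral_setU//; last 3 first.
  - exact: mhw.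
  - move=> x; rewrite /= !in_itv/= => -[/andP[x0 xt]|/andP[tx x1]].
      by rewrite hw0// (le_lt_trans xt).
    by rewrite hw0// (lt_trans t0).
  - rewrite disj_set2E; apply/eqP; rewrite -subset0 => x [] /=.
    by rewrite !in_itv/= => /andP[_ xt] /andP[tx _]; move: xt; rewrite leNgt tx.
  rewrite -itv_bndbnd_setU ?bnd_simp ?ltW//.
  apply: eq_integral => x; rewrite inE/= in_itv/= => /andP[x0 x1].
  by rewrite hwK.
have m10 : (0 <= m1)%E.
  apply: integral_ge0 => x /=; rewrite in_itv/= => /andP[x0 xt].
  by rewrite hw0// (le_lt_trans xt).
have m20 : (0 <= m2)%E.
  by apply: integral_ge0 => x /DP0/andP[x0 x1]; rewrite hw0.
have m12y : (m1 + m2 < +oo)%E by rewrite -mE ltry.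
have m2fin : m2 \is a fin_num.
  by rewrite ge0_fin_numE//; apply: le_lt_trans m12y; exact: leeDr.
have m1fin : m1 \is a fin_num.
  by rewrite ge0_fin_numE//; apply: le_lt_trans m12y; exact: leeDl.
have m1le : (m1 <= (t ^+ k * rbeta_fun 1 (b + j%:R))%:E)%E.
  rewrite EFinM -rbeta_funE//.
  have tk0 : 0 <= t ^+ k by rewrite exprn_ge0 ?ltW.
  rewrite /erbeta -ge0_integralZl//; last 2 first.
  - by apply/measurable_EFinP; exact: measurable_rbeta_kernel.
  - by move=> x _; rewrite lee_fin rbeta_kernel_ge0.
  have mK (A : set R) : measurable_fun A
      (fun x => ((t ^+ k)%:E * (rbeta_kernel 1 (b + j%:R) x)%:E)%E).
    apply: emeasurable_funM => //.
    by apply/measurable_EFinP; exact: measurable_rbeta_kernel.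
  apply: (@le_trans _ _ (\int[lebesgue_measure]_(x in `]0%R, t]%classic)
    ((t ^+ k)%:E * (rbeta_kernel 1 (b + j%:R) x)%:E))%E).
    apply: ge0_le_integral => //.
    - move=> x /=; rewrite in_itv/= => /andP[x0 xt].
      by rewrite hw0// (le_lt_trans xt).
    - exact: mhw.
    - exact: mK.
    - move=> x /=; rewrite in_itv/= => /andP[x0 xt].
      have x1 := le_lt_trans xt t1.
      rewrite -EFinM lee_fin hwK// /rbeta_kernel subrr powRr0 mul1r.
      rewrite ler_wpM2r ?powR_ge0// -natr1 addrK powR_mulrn ?(ltW x0)//.
      by apply: lerXn2r; rewrite ?nnegrE ?(ltW x0) ?(ltW t0).
  apply: ge0_subset_integral => //.
  - exact: mK.
  - by move=> x _; rewrite -EFinM lee_fin mulr_ge0 ?rbeta_kernel_ge0.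
  - by apply: subset_itvl; rewrite bnd_simp.
have mhf : measurable_fun D (fun x => ((h x)%:E * (f x)%:E)%E).
  apply: emeasurable_funM; apply/measurable_EFinP => //.
  exact: measurable_funTS.
have hf0 x : D x -> (0 <= (h x)%:E * (f x)%:E)%E.
  move=> Dx; rewrite -EFinM lee_fin mulr_ge0 ?f0 ?DP//.
  by have /andP[] := DP0 _ Dx; exact: h0.
have e20 : (0 <= e2)%E by apply: integral_ge0 => x; exact: hf0.
have Zm2 r : 0 <= r -> (r%:E * m2 =
    \int[lebesgue_measure]_(x in D) (r%:E * (h x * w x)%:E))%E.
  move=> r0; rewrite /m2 -ge0_integralZl//; first exact: mhw.
  by move=> x /DP0/andP[x0 x1]; rewrite hw0.
have e2u : (e2 <= (c + eps)%:E * m2)%E.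
  rewrite Zm2 ?addr_ge0 ?(ltW eps0)//.
  apply: ge0_le_integral => //.
  - by apply: emeasurable_funM => //; exact: mhw.
  - move=> x Dx; have /andP[x0 x1] := DP0 _ Dx.
    rewrite -!EFinM lee_fin mulrCA ler_wpM2l ?h0//.
    have := fc _ (DP _ Dx); rewrite ler_norml => /andP[_].
    by rewrite lerBlDl ler_pdivrMr ?w0.
have e2fin : e2 \is a fin_num.
  by rewrite ge0_fin_numE// (le_lt_trans e2u)// -(fineK m2fin) -EFinM ltry.
have e2l : (c%:E * m2 <= e2 + eps%:E * m2)%E.
  rewrite !Zm2 ?(ltW eps0)//.
  rewrite /e2 -ge0_integralD//; last 2 first.
  - move=> x /DP0/andP[x0 x1]; rewrite mule_ge0 ?hw0// lee_fin ltW//.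
  - by apply: emeasurable_funM => //; exact: mhw.
  apply: ge0_le_integral => //.
  - by move=> x /DP0/andP[x0 x1]; rewrite mule_ge0 ?hw0.
  - by apply: emeasurable_funM => //; exact: mhw.
  - apply: emeasurable_funD; first exact: mhf.
    by apply: emeasurable_funM => //; exact: mhw.
  - move=> x Dx; have /andP[x0 x1] := DP0 _ Dx.
    rewrite -!EFinM -EFinD lee_fin mulrCA [eps * _]mulrCA -mulrDr.
    rewrite ler_wpM2l ?h0//.
    have := fc _ (DP _ Dx); rewrite ler_norml => /andP[+ _].
    rewrite lerBrDl lerBlDr -/(w x) => hh.
    have := ler_wpM2r (ltW (w0 _ x1)) hh.
    by rewrite mulrDl divfK// gt_eqF ?w0.
exists (fine e2), (fine m2); split.
- by rewrite fineK.
- exact: fine_ge0.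
- by rewrite -lee_fin EFinM EFinD EFinM !fineK.
- by rewrite -lee_fin EFinM !fineK.
- rewrite -!lee_fin mE EFinD !fineK//; apply/andP; split.
    by rewrite leeDr.
  by rewrite leeD2r.
Qed.

Lemma moment_localization (R : realType) (G : latent_law R) (b c eps : R)
    (j : nat) : 0 < b -> 0 <= c -> 0 < eps -> on_unit G -> tail_density G b c ->
  exists t C : R, [/\ 0 < t < 1, 0 <= C & forall k,
    `|\int[G]_x (x ^+ k * (1 - x) ^+ j) - c * rbeta_fun k.+1%:R (b + j%:R)|
     <= eps * rbeta_fun k.+1%:R (b + j%:R) + C * t ^+ k].
Proof.
move=> b0 c0 eps0 GU [G1 [e [f [e0 mf f0 GE]]]].
move=> /cvgrPdist_le/(_ _ eps0)[r /= r0 fr].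
(* Beyond 1 - r the limit is eps-accurate, beyond 1 - e the density exists, and 1/2 keeps t
   positive. None of these depends on k. *)
pose t := Num.max (Num.max (1 - r) (1 - e)) 2^-1.
have t01 : 0 < t < 1.
  by rewrite lt_max invr_gt0 ltr0n orbT/= !gt_max !ltrBlDr !ltrDl r0 e0 invf_lt1// ltr1n.
have tr : 1 - r <= t by rewrite !le_max lexx.
have te : 1 - e <= t by rewrite !le_max lexx orbT.
have subD : (`]t, 1[%classic : set R) `<=` `]1 - e, 1[%classic.
  by apply: subset_itvr; rewrite bnd_simp.
have mfD : measurable_fun `]t, 1[%classic f.
  by apply: measurable_funS mf => //; exact: measurable_itv.
have f0D x : t < x < 1 -> 0 <= f x.
  by move=> /andP[tx x1]; apply: f0; rewrite in_itv/= x1 (le_lt_trans te).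
have fc x : t < x < 1 -> `|f x / (1 - x) `^ (b - 1) - c| <= eps.
  move=> /andP[tx x1]; rewrite distrC; apply: fr => //=.
  rewrite gtr0_norm ?subr_gt0// ltrBlDr -ltrBlDl.
  exact: le_lt_trans tx.
have bj0 : 0 < b + j%:R by rewrite ltr_wpDr.
have B1 : 0 <= rbeta_fun 1 (b + j%:R) by rewrite ltW// rbeta_fun_gt0.
(* The summand 1 pays for the moment on [0, t], the other one for c times the Beta integral on ]0,
   t]. *)
exists t, (1 + c * rbeta_fun 1 (b + j%:R)); split => // [|k].
  by rewrite addr_ge0// mulr_ge0.
have [e2 [m [e2E m0 l1 l2 /andP[l3 l4]]]] :=
  @tail_moment_bounds R f t b c eps j k t01 b0 c0 eps0 mfD f0D fc.
pose h (x : measurableTypeR R) := x ^+ k * (1 - x) ^+ j.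
have mh : measurable_fun setT h.
  by apply: measurable_funM; apply: measurable_funX => //; exact: measurable_funB.
have mhE (D : set (measurableTypeR R)) : measurable_fun D (fun x => (h x)%:E).
  by apply/measurable_EFinP; exact: measurable_funTS.
have h0 x : 0 <= x -> x < 1 -> 0 <= h x.
  by move=> x0 x1; rewrite mulr_ge0 ?exprn_ge0// subr_ge0 ltW.
have [t0 t1] := andP t01.
pose I1 : set (measurableTypeR R) := `[0, t]%classic.
pose I2 : set (measurableTypeR R) := `]t, 1[%classic.
have mI1 : measurable I1 by exact: measurable_itv.
have mI2 : measurable I2 by exact: measurable_itv.
have UI : `[0, 1[%classic = I1 `|` I2.
  by rewrite /I1 /I2 -itv_bndbnd_setU ?bnd_simp// ltW.
have U0 x : (I1 `|` I2) x -> (0%:E <= (h x)%:E)%E.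
  by rewrite -UI /= in_itv/= => /andP[x0 x1]; rewrite lee_fin h0.
have e1u : (\int[G]_(x in I1) (h x)%:E <= (t ^+ k)%:E)%E.
  apply: (@le_trans _ _ (\int[G]_(x in I1) (cst (t ^+ k)%:E x))%E).
    apply: ge0_le_integral => //.
    - by move=> x Ix; apply: U0; left.
    - move=> x; rewrite /I1 /= in_itv/= => /andP[x0 xt].
      rewrite lee_fin /h -[leRHS]mulr1 ler_pM ?exprn_ge0 ?subr_ge0//.
      + by rewrite ltW// (le_lt_trans xt).
      + by apply: lerXn2r; rewrite ?nnegrE ?(ltW t0).
      + by rewrite exprn_ile1 ?gerBl// subr_ge0 ltW// (le_lt_trans xt).
  rewrite integral_cst// -[leRHS]mule1 lee_wpmul2l ?lee_fin ?exprn_ge0 ?(ltW t0)//.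
  exact: probability_le1.
have e10 : (0 <= \int[G]_(x in I1) (h x)%:E)%E.
  by apply: integral_ge0 => x Ix; apply: U0; left.
have e1fin : (\int[G]_(x in I1) (h x)%:E)%E \is a fin_num.
  by rewrite ge0_fin_numE// (le_lt_trans e1u)// ltry.
have -> : \int[G]_x h x = fine (\int[G]_(x in I1) (h x)%:E)%E + e2.
  (* An atom at 1 would contribute a term constant in k when j = 0; its absence reduces the integral
     to [0, 1[. *)
  rewrite (Rintegral_full_measure _ (on_unit_co GU G1))//.
  rewrite /Rintegral UI ge0_integral_setU//; last first.
    rewrite disj_set2E; apply/eqP; rewrite -subset0 => x [] /=.
    by rewrite /I1 /I2/= !in_itv/= => /andP[_ xt] /andP[tx _]; move: xt; rewrite leNgt tx.
  rewrite (@ge0_integral_density _ _ _ lebesgue_measure _ I2 f)//.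
  - have -> : (\int[lebesgue_measure]_(x in I2) ((h x)%:E * (f x)%:E) = e2%:E)%E.
      exact: e2E.
    by rewrite fineD.
  - by move=> B mB BI; apply: GE => //; exact: subset_trans subD.
  - by move=> x Ix; apply: U0; right.
have E0 : 0 <= fine (\int[G]_(x in I1) (h x)%:E)%E by exact: fine_ge0.
have E1 : fine (\int[G]_(x in I1) (h x)%:E)%E <= t ^+ k.
  by rewrite -lee_fin fineK.
move: E0 E1; set e1 := fine _ => E0 E1.
set M := rbeta_fun k.+1%:R _ in l3 l4 *; set B := rbeta_fun 1 _ in l4 B1 *.
have tk0 : 0 <= t ^+ k by rewrite exprn_ge0 ?ltW.
rewrite ler_norml; apply/andP; split; nra.
Qed.

(** After division by the Beta value the remainder C t^k vanishes by [geometric_rbeta_cvg0], which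
    leaves the relative error. *)
Lemma moment_cvg (R : realType) (G : latent_law R) (b c : R) (j : nat) :
  0 < b -> 0 <= c -> on_unit G -> tail_density G b c ->
  (\int[G]_x (x ^+ k * (1 - x) ^+ j)) / rbeta_fun k.+1%:R (b + j%:R)
    @[k --> \oo] --> c.
Proof.
move=> b0 c0 GU Gt; apply/cvgrPdist_le => eps eps0.
have e20 : 0 < eps / 2 by rewrite divr_gt0.
have [t [C [t01 C0 H]]] := @moment_localization R G b c (eps / 2) j b0 c0 e20 GU Gt.
have bj0 : 0 < b + j%:R by rewrite ltr_wpDr.
have : C * (t ^+ k / rbeta_fun k.+1%:R (b + j%:R)) @[k --> \oo] --> C * 0.
  by apply: cvgM; [exact: cvg_cst|exact: geometric_rbeta_cvg0].
rewrite mulr0 => /cvgrPdist_le/(_ _ e20) Hn.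
near=> k.
have M0 : 0 < rbeta_fun k.+1%:R (b + j%:R) by exact: rbeta_fun_gt0.
have : `|0 - C * (t ^+ k / rbeta_fun k.+1%:R (b + j%:R))| <= eps / 2.
  by near: k.
have {H} := H k.
set A := \int[G]_x _; move: M0; set M := rbeta_fun _ _ => M0 h1.
rewrite sub0r normrN mulrA => h2.
have h3 : C * t ^+ k / M <= eps / 2 by exact: le_trans (ler_norm _) h2.
have -> : c - A / M = (c * M - A) / M by field; rewrite gt_eqF.
rewrite normrM (gtr0_norm (x := M^-1)) ?invr_gt0// ler_pdivrMr// distrC.
move: h3; rewrite ler_pdivrMr//; lra.
Unshelve. all: by end_near. Qed.

(** * Reliability in terms of moments *)

(** The constant vector [acc] is the only one in which all gates accept, so the two events consist
    of one and two points of the joint law. *)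
Lemma reliabilityE (R : realType) (p0 : R) (G H : latent_law R) (k : nat) :
  reliability p0 G H k = p0 * \int[H]_x (x ^+ k) /
    (p0 * \int[H]_x (x ^+ k) + (1 - p0) * \int[G]_x (x ^+ k)).
Proof.
pose acc : verdicts k := [ffun=> true].
have accP (v : verdicts k) : [forall i, v i] = (v == acc).
  apply/forallP/eqP => [h|-> i]; last by rewrite ffunE.
  by apply/ffunP => i; rewrite ffunE; exact/h.
have intE (P : latent_law R) :
    \int[P]_x verdicts_given x acc = \int[P]_x (x ^+ k).
  apply: eq_Rintegral => x _; rewrite /verdicts_given.
  under eq_bigr do rewrite ffunE.
  by rewrite prodr_const card_ord.
have E1 : (correct k :&: all_accept k)%SET = [set (true, acc)]%SET.
  apply/setP => -[u v]; rewrite !inE /= accP xpair_eqE.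
  by case: u.
have E2 : all_accept k = [set (true, acc); (false, acc)]%SET.
  apply/setP => -[u v]; rewrite !inE /= accP !xpair_eqE.
  by case: u; rewrite ?orbF.
rewrite /reliability /joint_prob E1 E2 big_set1 big_setU1 ?inE ?xpair_eqE//=.
by rewrite big_set1 /joint_pmf /= !intE.
Qed.

Section on_unit_moments.
Context {R : realType} (G : latent_law R).
Hypothesis GU : on_unit G.

Lemma moment_on_unitE (f : R -> R) : measurable_fun setT f ->
  \int[G]_x f x = \int[G]_(x in `[0, 1]%classic) f x.
Proof. by move=> mf; apply: Rintegral_full_measure. Qed.

Lemma moment_ge0 (k : nat) : 0 <= \int[G]_x (x ^+ k).
Proof.
rewrite moment_on_unitE; last exact: measurable_funX.
by apply: Rintegral_ge0 => x; rewrite /= in_itv/= => /andP[x0 _]; rewrite exprn_ge0.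
Qed.

Lemma integrable_moment (k : nat) :
  G.-integrable `[0, 1]%classic (fun x => (x ^+ k)%:E).
Proof.
apply: measurable_bounded_integrable => //.
- by rewrite ltey_eq fin_num_measure.
- exists 1; split; first exact: num_real.
  move=> M M1 x /=; rewrite in_itv/= => /andP[x0 x1].
  by rewrite ger0_norm ?exprn_ge0// (le_trans _ (ltW M1))// exprn_ile1.
Qed.

(** The exponent [^+ 1] is kept so that the difference matches [moment_cvg] at j = 1. *)
Lemma moment_sub (k : nat) :
  \int[G]_x (x ^+ k) - \int[G]_x (x ^+ k.+1) =
  \int[G]_x (x ^+ k * (1 - x) ^+ 1).
Proof.
have mX n : measurable_fun setT (fun x : measurableTypeR R => x ^+ n).
  exact: measurable_funX.
rewrite !moment_on_unitE//; last first.
  by apply: measurable_funM => //; apply: measurable_funX; exact: measurable_funB.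
rewrite -RintegralB//; try exact: integrable_moment.
apply: eq_Rintegral => x _; rewrite exprS expr1; ring.
Qed.

End on_unit_moments.

(** * Comparison of the moments of two laws *)

(** Prepares the composition with the logarithm, whose limit -oo at 0 is one-sided. *)
Lemma cvg_at_right0 (R : realType) (u : nat -> R) :
  (\forall k \near \oo, 0 < u k) -> u k @[k --> \oo] --> (0 : R) ->
  u k @[k --> \oo] --> (0 : R)^'+.
Proof.
move=> u0 ucvg A /= A0.
have := ucvg _ A0; rewrite /= => Au.
change (\forall k \near \oo, A (u k)).
have {}Au : \forall k \near \oo, 0 < u k -> A (u k) by exact: Au.
by near=> k; have : 0 < u k -> A (u k); [near: k|apply; near: k].
Unshelve. all: by end_near. Qed.

(** The Beta law with parameters 1 and b has k-th moment B(k + 1, b) / B(1, b). Seen with the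
    smaller exponent b' it has tail constant 0, so [moment_cvg] gives the claim. *)
Lemma rbeta_ratio_cvg0 (R : realType) (b b' : R) : 0 < b' -> b' < b ->
  rbeta_fun k.+1%:R b / rbeta_fun k.+1%:R b' @[k --> \oo] --> (0 : R).
Proof.
move=> b'0 b'b; have b0 := lt_trans b'0 b'b.
have [G GE] := beta_law_exists (@ltr01 R) b0.
have GU := beta_law_on_unit ltr01 b0 GE.
have := beta_law_tail_density ltr01 b0 GE (ltW b'b).
rewrite gt_eqF// mul0r => /(moment_cvg 0 b'0 (lexx 0) GU) h.
have : rbeta_fun 1 b * (\int[G]_x (x ^+ k * (1 - x) ^+ 0) /
    rbeta_fun k.+1%:R (b' + 0%:R)) @[k --> \oo] --> rbeta_fun 1 b * 0.
  by apply: cvgM => //; exact: cvg_cst.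
rewrite mulr0; apply: cvg_trans; apply: near_eq_cvg; apply: nearW => k.
under eq_Rintegral do rewrite expr0 mulr1.
rewrite addr0 (beta_law_moment ltr01 b0 GE) nat1r mulrA mulrCA mulfV ?mulr1//.
by rewrite gt_eqF// rbeta_fun_gt0.
Qed.

Lemma tail_exponent_density (R : realType) (G : latent_law R) (b : R) :
  tail_exponent G b -> 0 < b /\ exists2 c, 0 < c & tail_density G b c.
Proof.
move=> [G1 [c [e [f [b0 [c0 e0] mf f0 [GE fc]]]]]]; split=> //.
by exists c => //; split => //; exists e, f.
Qed.

Section tail.
Context {R : realType} (G : latent_law R) (b c : R).
Hypotheses (b0 : 0 < b) (c0 : 0 < c) (GU : on_unit G) (Gt : tail_density G b c).

Lemma tail_moment_cvg :
  (\int[G]_x (x ^+ k)) / rbeta_fun k.+1%:R b @[k --> \oo] --> c.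
Proof.
have := moment_cvg 0 b0 (ltW c0) GU Gt; apply: cvg_trans.
apply: near_eq_cvg; apply: nearW => k; rewrite addr0; congr (_ / _).
by apply: eq_Rintegral => x _; rewrite expr0 mulr1.
Qed.

Lemma tail_moment_gt0 : \forall k \near \oo, 0 < \int[G]_x (x ^+ k).
Proof.
have h : \forall k \near \oo, 0 < \int[G]_x (x ^+ k) / rbeta_fun k.+1%:R b.
  by move/cvgr_gt: tail_moment_cvg => /(_ _ c0).
apply: filterS h => k; rewrite pmulr_lgt0// invr_gt0.
exact: rbeta_fun_gt0.
Qed.

Lemma tail_moment_decrease :
  k.+1%:R * (1 - \int[G]_x (x ^+ k.+1) / \int[G]_x (x ^+ k)) @[k --> \oo] --> b.
Proof.
have h1 := moment_cvg 1 b0 (ltW c0) GU Gt.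
have h0 := tail_moment_cvg.
have hk : (k.+1%:R + b)^-1 @[k --> \oo] --> (0 : R).
  apply: (@squeeze_cvgr _ _ _ _ (fun=> 0) (fun k => k.+1%:R^-1)).
  - apply: nearW => k; rewrite invr_ge0 addr_ge0 ?(ltW b0)//=.
    by rewrite lef_pV2 ?posrE ?addr_gt0// lerDl ltW.
  - exact: cvg_cst.
  - exact: cvg_harmonic.
(* The first factor is (k + 1) B(k + 1, b + 1) / B(k + 1, b); in the second, both normalized moments
   tend to c and the constant cancels. *)
have h : b * (1 - b * (k.+1%:R + b)^-1) *
   ((\int[G]_x (x ^+ k * (1 - x) ^+ 1)) / rbeta_fun k.+1%:R (b + 1%:R) /
    ((\int[G]_x (x ^+ k)) / rbeta_fun k.+1%:R b)) @[k --> \oo] -->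
   b * (1 - b * 0) * (c / c).
  apply: cvgM.
    apply: cvgM; first exact: cvg_cst.
    apply: cvgB; first exact: cvg_cst.
    by apply: cvgM; first exact: cvg_cst.
  by apply: cvgM => //; apply: cvgV => //; rewrite gt_eqF.
rewrite mulr0 subr0 mulr1 divff ?gt_eqF// mulr1 in h.
apply: cvg_trans h; apply: near_eq_cvg; near=> k.
have A0 : 0 < \int[G]_x (x ^+ k) by near: k; exact: tail_moment_gt0.
have k0 : 0 < k.+1%:R :> R by [].
rewrite -moment_sub// rbeta_funSr//.
have B0 : 0 < rbeta_fun k.+1%:R b by exact: rbeta_fun_gt0.
move: A0 B0; set A := \int[G]_x _; set B := rbeta_fun _ _.
set A' := \int[G]_x _ => A0 B0; field.
have kb0 : k.+1%:R + b != 0 by rewrite gt_eqF// addr_gt0.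
by rewrite nat1r kb0 !gt_eqF.
Unshelve. all: by end_near. Qed.

End tail.

Lemma near_inftyS_inv (P : nat -> Prop) :
  (\forall k \near \oo, P k) -> \forall k \near \oo, P k.+1.
Proof. by move=> [N _ NP]; exists N => // k Nk; apply: NP; exact: leqW. Qed.

Section compare_tails.
Context {R : realType} (G H : latent_law R) (b b' c c' : R).
Hypotheses (b0 : 0 < b) (c0 : 0 < c) (GU : on_unit G) (Gt : tail_density G b c).
Hypotheses (b'0 : 0 < b') (c'0 : 0 < c') (HU : on_unit H)
  (Ht : tail_density H b' c').
(** The section treats only b' < b; the opposite case is obtained by instantiating it with the two
    laws exchanged. *)
Let rho k := \int[G]_x (x ^+ k) / \int[H]_x (x ^+ k).

Lemma moment_ratio_gt0 : \forall k \near \oo, 0 < rho k.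
Proof.
by near=> k; apply: divr_gt0; near: k;
  [exact: tail_moment_gt0 Gt|exact: tail_moment_gt0 Ht].
Unshelve. all: by end_near. Qed.

Lemma moment_ratio_cvg (l : R) :
  rbeta_fun k.+1%:R b / rbeta_fun k.+1%:R b' @[k --> \oo] --> l ->
  rho k @[k --> \oo] --> c / c' * l.
Proof.
move=> hl.
have h : (\int[G]_x (x ^+ k)) / rbeta_fun k.+1%:R b /
    ((\int[H]_x (x ^+ k)) / rbeta_fun k.+1%:R b') *
    (rbeta_fun k.+1%:R b / rbeta_fun k.+1%:R b') @[k --> \oo] --> c / c' * l.
  apply: cvgM => //; apply: cvgM; first exact: tail_moment_cvg Gt.
  by apply: cvgV; [rewrite gt_eqF|exact: tail_moment_cvg Ht].
apply: cvg_trans h; apply: near_eq_cvg; near=> k.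
have A0 : 0 < \int[H]_x (x ^+ k) by near: k; exact: tail_moment_gt0 Ht.
have B0 : 0 < rbeta_fun k.+1%:R b by exact: rbeta_fun_gt0.
have B'0 : 0 < rbeta_fun k.+1%:R b' by exact: rbeta_fun_gt0.
by rewrite /rho; field; rewrite !gt_eqF.
Unshelve. all: by end_near. Qed.

Lemma moment_ratio_cvg0 : b' < b -> rho k @[k --> \oo] --> (0 : R).
Proof.
by move=> b'b; rewrite -(mulr0 (c / c')); apply: moment_ratio_cvg;
  exact: rbeta_ratio_cvg0.
Qed.

(** The k-th moment loses a fraction of about b / k for [G] and b' / k for [H] at the next step. The
    midpoint m eventually separates the two rescaled losses, so the moments of [G] shrink by the
    larger factor. *)
Lemma moment_ratio_decr : b' < b -> \forall k \near \oo, rho k.+1 < rho k.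
Proof.
move=> b'b; pose m := (b + b') / 2.
have mb : m < b by rewrite /m; lra.
have b'm : b' < m by rewrite /m; lra.
have hG : \forall k \near \oo,
    m < k.+1%:R * (1 - \int[G]_x (x ^+ k.+1) / \int[G]_x (x ^+ k)).
  exact: (cvgr_gt b (tail_moment_decrease b0 c0 GU Gt) m mb).
have hH : \forall k \near \oo,
    k.+1%:R * (1 - \int[H]_x (x ^+ k.+1) / \int[H]_x (x ^+ k)) < m.
  exact: (cvgr_lt b' (tail_moment_decrease b'0 c'0 HU Ht) m b'm).
near=> k.
have A0 : 0 < \int[G]_x (x ^+ k) by near: k; exact: tail_moment_gt0 Gt.
have A'0 : 0 < \int[H]_x (x ^+ k) by near: k; exact: tail_moment_gt0 Ht.
have A'1 : 0 < \int[H]_x (x ^+ k.+1).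
  by near: k; exact: near_inftyS_inv (tail_moment_gt0 b'0 c'0 HU Ht).
have : k.+1%:R * (1 - \int[H]_x (x ^+ k.+1) / \int[H]_x (x ^+ k)) <
       k.+1%:R * (1 - \int[G]_x (x ^+ k.+1) / \int[G]_x (x ^+ k)).
  by apply: (@lt_trans _ _ m); near: k.
rewrite ltr_pM2l// ltrD2l ltrN2 ltr_pdivrMr// mulrAC ltr_pdivlMr// => lt1.
by rewrite /rho ltr_pdivrMr// mulrAC ltr_pdivlMr// [ltRHS]mulrC.
Unshelve. all: by end_near. Qed.

End compare_tails.

(** * Transfer to reliability and log-odds; the eventual direction *)

(** Exhibits the reliability as p0 x / (p0 x + 1 - p0) at the moment ratio x; [odds_cvg] and
    [ltr_odds] supply continuity and strict monotonicity of this map for x >= 0. *)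
Lemma reliability_ratio (R : realType) (p0 : R) (G H : latent_law R) (k : nat) :
  \int[G]_x (x ^+ k) != 0 ->
  reliability p0 G H k = p0 * (\int[H]_x (x ^+ k) / \int[G]_x (x ^+ k)) /
    (p0 * (\int[H]_x (x ^+ k) / \int[G]_x (x ^+ k)) + (1 - p0)).
Proof.
move=> A0; rewrite reliabilityE; set A := \int[G]_x _ in A0 *.
set B := \int[H]_x _.
have -> : p0 * (B / A) + (1 - p0) = (p0 * B + (1 - p0) * A) / A.
  by rewrite mulrDl mulfK// mulrA.
by rewrite invf_div !mulrA divfK.
Qed.

Lemma log_oddsE (R : realType) (p0 : R) (G H : latent_law R) (k : nat) :
  0 < p0 < 1 -> 0 < \int[G]_x (x ^+ k) -> 0 < \int[H]_x (x ^+ k) ->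
  log_odds p0 G H k =
    logit p0 + ln (\int[H]_x (x ^+ k) / \int[G]_x (x ^+ k)).
Proof.
move=> /andP[p0_gt0 p01] A0 B0.
have q0 : 0 < 1 - p0 by rewrite subr_gt0.
rewrite /log_odds /logit -lnM ?posrE ?divr_gt0// reliabilityE; congr ln.
move: A0 B0; set A := \int[G]_x _; set B := \int[H]_x _ => A0 B0.
have D0 : 0 < p0 * B + (1 - p0) * A by rewrite addr_gt0// mulr_gt0.
have -> : 1 - p0 * B / (p0 * B + (1 - p0) * A) =
    (1 - p0) * A / (p0 * B + (1 - p0) * A).
  by field; rewrite gt_eqF.
by field; rewrite !gt_eqF.
Qed.

Lemma odds_cvg (R : realType) (p0 l : R) (u : nat -> R) : 0 < p0 < 1 -> 0 <= l ->
  u k @[k --> \oo] --> l ->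
  p0 * u k / (p0 * u k + (1 - p0)) @[k --> \oo] --> p0 * l / (p0 * l + (1 - p0)).
Proof.
move=> /andP[p0_gt0 p01] l0 ul.
have pu : p0 * u k @[k --> \oo] --> p0 * l by apply: cvgM; [exact: cvg_cst|].
apply: cvgM => //; apply: cvgV.
  by rewrite gt_eqF// ltr_wpDl ?subr_gt0// mulr_ge0// ltW.
by apply: cvgD => //; exact: cvg_cst.
Qed.

Lemma ltr_odds (R : realType) (p0 x y : R) : 0 < p0 < 1 -> 0 <= x -> 0 <= y ->
  (p0 * x / (p0 * x + (1 - p0)) < p0 * y / (p0 * y + (1 - p0))) = (x < y).
Proof.
move=> /andP[p0_gt0 p01] x0 y0.
have q0 : 0 < 1 - p0 by rewrite subr_gt0.
have D0 z : 0 <= z -> 0 < p0 * z + (1 - p0).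
  by move=> z0; rewrite ltr_wpDl// mulr_ge0// ltW.
rewrite ltr_pdivrMr ?D0// mulrAC ltr_pdivlMr ?D0//.
rewrite -subr_gt0 (_ : _ - _ = p0 * (1 - p0) * (y - x)); last by ring.
by rewrite pmulr_rgt0 ?mulr_gt0// subr_gt0.
Qed.

Section tail_direction.
Context {R : realType} (p0 : R) (G H : latent_law R) (b b' : R).
Hypotheses (p01 : 0 < p0 < 1) (GU : on_unit G) (HU : on_unit H).
Hypotheses (Gb : tail_exponent G b) (Hb : tail_exponent H b').

Lemma log_odds_near : \forall k \near \oo,
  log_odds p0 G H k =
    logit p0 + ln (\int[H]_x (x ^+ k) / \int[G]_x (x ^+ k)).
Proof.
have [b0 [c c0 Gt]] := tail_exponent_density Gb.
have [b'0 [c' c'0 Ht]] := tail_exponent_density Hb.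
by near=> k; apply: log_oddsE => //; near: k;
  [exact: tail_moment_gt0 Gt|exact: tail_moment_gt0 Ht].
Unshelve. all: by end_near. Qed.

Lemma log_odds_nearS : \forall k \near \oo,
  log_odds p0 G H k.+1 =
    logit p0 + ln (\int[H]_x (x ^+ k.+1) / \int[G]_x (x ^+ k.+1)).
Proof. exact: near_inftyS_inv log_odds_near. Qed.

Lemma tail_harm : b < b' ->
  [/\ log_odds p0 G H k @[k --> \oo] --> -oo,
      reliability p0 G H k @[k --> \oo] --> (0 : R) &
      \forall k \near \oo, log_odds p0 G H k.+1 < log_odds p0 G H k].
Proof.
move=> bb'.
have [b0 [c c0 Gt]] := tail_exponent_density Gb.
have [b'0 [c' c'0 Ht]] := tail_exponent_density Hb.
have r0 := moment_ratio_cvg0 b'0 c'0 HU Ht b0 c0 GU Gt bb'.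
have rp := moment_ratio_gt0 b'0 c'0 HU Ht b0 c0 GU Gt.
have rd := moment_ratio_decr b'0 c'0 HU Ht b0 c0 GU Gt bb'.
split.
- have h := cvg_comp _ _ (cvg_at_right0 rp r0) (@lnNy R).
  apply/cvgrNyPle => A; near=> k.
  rewrite (near log_odds_near k)// -lerBrDl.
  by near: k; move/cvgrNyPle : h; apply.
- have := odds_cvg p01 (lexx 0) r0; rewrite mulr0 mul0r.
  apply: cvg_trans; apply: near_eq_cvg; near=> k.
  rewrite reliability_ratio// gt_eqF//.
  by near: k; exact: tail_moment_gt0 Gt.
- have rpS : \forall k \near \oo,
      0 < \int[H]_x (x ^+ k.+1) / \int[G]_x (x ^+ k.+1).
    exact: near_inftyS_inv rp.
  near=> k; rewrite (near log_odds_near k)// (near log_odds_nearS k)//.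
  rewrite ltrD2l ltr_ln ?posrE; last 2 first.
  + by near: k.
  + by near: k.
  by near: k.
Unshelve. all: by end_near. Qed.

End tail_direction.

Lemma tail_help (R : realType) (p0 : R) (G H : latent_law R) (b b' : R) :
  0 < p0 < 1 -> on_unit G -> on_unit H ->
  tail_exponent G b -> tail_exponent H b' -> b' < b ->
  log_odds p0 G H k @[k --> \oo] --> +oo /\
  \forall k \near \oo, log_odds p0 G H k < log_odds p0 G H k.+1.
Proof.
move=> p01 GU HU Gb Hb b'b.
have [b0 [c c0 Gt]] := tail_exponent_density Gb.
have [b'0 [c' c'0 Ht]] := tail_exponent_density Hb.
have r0 := moment_ratio_cvg0 b0 c0 GU Gt b'0 c'0 HU Ht b'b.
have rp := moment_ratio_gt0 b0 c0 GU Gt b'0 c'0 HU Ht.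
have rpS := near_inftyS_inv rp.
have rd := moment_ratio_decr b0 c0 GU Gt b'0 c'0 HU Ht b'b.
have lE := log_odds_near p01 GU HU Gb Hb.
have lES := log_odds_nearS p01 GU HU Gb Hb.
split.
- have h := cvg_comp _ _ (cvg_at_right0 rp r0) (@lnNy R).
  apply/cvgryPge => A; near=> k.
  have -> : log_odds p0 G H k =
      logit p0 + ln (\int[H]_x (x ^+ k) / \int[G]_x (x ^+ k)) by near: k.
  rewrite -invf_div lnV ?posrE; last by near: k.
  rewrite lerBrDr addrC -lerBrDr.
  by near: k; move/cvgrNyPle : h; apply.
- near=> k.
  have -> : log_odds p0 G H k =
      logit p0 + ln (\int[H]_x (x ^+ k) / \int[G]_x (x ^+ k)) by near: k.
  have -> : log_odds p0 G H k.+1 =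
      logit p0 + ln (\int[H]_x (x ^+ k.+1) / \int[G]_x (x ^+ k.+1)) by near: k.
  have A0 : 0 < \int[G]_x (x ^+ k) / \int[H]_x (x ^+ k) by near: k.
  have A1 : 0 < \int[G]_x (x ^+ k.+1) / \int[H]_x (x ^+ k.+1) by near: k.
  rewrite -[\int[H]_x (x ^+ k) / _]invf_div -[\int[H]_x (x ^+ k.+1) / _]invf_div.
  rewrite ltrD2l !lnV ?posrE// ltrN2 ltr_ln ?posrE//.
  by near: k.
Unshelve. all: by end_near. Qed.

(** With equal exponents the Beta values cancel and the moment ratio tends to c' / c. The limit is
    p0 c' / (p0 c' + (1 - p0) c), strictly between 0 and 1 because both constants are positive. *)
Lemma tail_plateau (R : realType) (p0 : R) (G H : latent_law R) (b : R) :
  0 < p0 < 1 -> on_unit G -> on_unit H ->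
  tail_exponent G b -> tail_exponent H b ->
  exists2 q : R, 0 < q < 1 & reliability p0 G H k @[k --> \oo] --> q.
Proof.
move=> p01 GU HU Gb Hb.
have [b0 [c c0 Gt]] := tail_exponent_density Gb.
have [_ [c' c'0 Ht]] := tail_exponent_density Hb.
have /(moment_ratio_cvg b0 c'0 HU Ht b0 c0 GU Gt) :
    rbeta_fun k.+1%:R b / rbeta_fun k.+1%:R b @[k --> \oo] --> (1 : R).
  under eq_fun do rewrite divff ?gt_eqF ?rbeta_fun_gt0//.
  exact: cvg_cst.
rewrite mulr1 => rl.
have q0 : 0 < c' / c by rewrite divr_gt0.
have [p0_gt0 p0_lt1] := andP p01.
have pq0 : 0 < p0 * (c' / c) by rewrite mulr_gt0.
have d0 : 0 < 1 - p0 by rewrite subr_gt0.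
have s0 : 0 < p0 * (c' / c) + (1 - p0) by exact: addr_gt0.
exists (p0 * (c' / c) / (p0 * (c' / c) + (1 - p0))).
  apply/andP; split; first exact: divr_gt0.
  by rewrite ltr_pdivrMr// mul1r ltrDl.
have := odds_cvg p01 (ltW q0) rl.
apply: cvg_trans; apply: near_eq_cvg; near=> k.
rewrite reliability_ratio// gt_eqF//.
by near: k; exact: tail_moment_gt0 Gt.
Unshelve. all: by end_near. Qed.

(** * The first gate, prescribed Beta laws and constant rates *)

Lemma first_gate_helps (R : realType) (p0 : R) (G H : latent_law R) :
  0 < p0 < 1 -> on_unit G -> on_unit H -> 1 < mean_LR G H ->
  first_gate_evidence p0 G H = ln (mean_LR G H) /\
  0 < first_gate_evidence p0 G H.
Proof.
move=> p01 GU HU LR1.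
(* A zero mean would make the quotient 0 by the convention for division, against the hypothesis that
   it exceeds 1. *)
have mG0 : 0 < mean G.
  rewrite lt_neqAle (moment_ge0 GU 1) andbT; apply/eqP => mG.
  by move: LR1; rewrite /mean_LR -mG invr0 mulr0 ltr10.
have mH0 : 0 < mean H.
  have : mean G < mean H.
    by move: LR1; rewrite /mean_LR ltr_pdivlMr// mul1r.
  exact: lt_trans.
have E : first_gate_evidence p0 G H = ln (mean_LR G H).
  by rewrite /first_gate_evidence log_oddsE// addrC addKr.
by rewrite E ln_gt0.
Qed.

Lemma constant_law_moment (R : realType) (a : R) (k : nat) :
  \int[constant_law a]_x (x ^+ k) = a ^+ k.
Proof.
rewrite /Rintegral integral_dirac//; last first.
  by apply/measurable_EFinP; exact: measurable_funX.
by rewrite diracT mul1e.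
Qed.

Lemma beta_law_tail_exponent (R : realType) (a b : R) (G : latent_law R) :
  0 < a -> 0 < b -> is_beta_law a b G -> tail_exponent G b.
Proof.
move=> a0 b0 GE.
have [G1 [e [f [e0 mf f0 fE fc]]]] := beta_law_tail_density a0 b0 GE (lexx b).
split=> //; exists ((b == b)%:R / rbeta_fun a b), e, f; split => //; split => //.
by rewrite eqxx divr_gt0// rbeta_fun_gt0.
Qed.

Lemma beta_law_mean_exists (R : realType) (b m : R) : 0 < b -> 0 < m < 1 ->
  exists G : latent_law R, [/\ on_unit G, tail_exponent G b & mean G = m].
Proof.
move=> b0 /andP[m0 m1].
have q0 : 0 < 1 - m by rewrite subr_gt0.
(* This first parameter solves a / (a + b) = m. *)
have a0 : 0 < b * m / (1 - m) by rewrite divr_gt0 ?mulr_gt0.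
have [G GE] := beta_law_exists a0 b0.
exists G; split.
- exact: beta_law_on_unit GE.
- exact: beta_law_tail_exponent GE.
- rewrite (beta_law_mean a0 b0 GE); field.
  rewrite (gt_eqF q0) gt_eqF//.
  by apply: addr_gt0; exact: mulr_gt0.
Qed.

(** Moments of constant rates are powers, so the moment ratio is L^k and the dichotomy is that of a
    geometric sequence. *)
Lemma constant_rates (R : realType) (p0 a b : R) :
  0 < p0 < 1 -> 0 < a <= 1 -> 0 <= b <= 1 ->
  let G := constant_law a in
  let H := constant_law b in
  let r := reliability p0 G H in
  [/\ mean_LR G H = b / a,
      (forall k, (0 < k)%N -> (p0 < r k <-> 1 < mean_LR G H)),
      (forall k, (r k < r k.+1 <-> 1 < mean_LR G H)),
      (1 < mean_LR G H -> r k @[k --> \oo] --> (1 : R)) &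
      (mean_LR G H = 1 -> forall k, r k = p0) /\
      (mean_LR G H < 1 -> r k @[k --> \oo] --> (0 : R))].
Proof.
move=> p01 /andP[a0 a1] /andP[b0 b1] G H r.
have LRE : mean_LR G H = b / a.
  by rewrite /mean_LR /mean (constant_law_moment a 1) (constant_law_moment b 1).
rewrite LRE; set L := b / a.
have L0 : 0 <= L by rewrite divr_ge0// ltW.
have [p0_gt0 p0_lt1] := andP p01.
have q0 : 0 < 1 - p0 by rewrite subr_gt0.
have rE k : r k = p0 * L ^+ k / (p0 * L ^+ k + (1 - p0)).
  rewrite /r reliability_ratio !constant_law_moment ?expf_neq0 ?gt_eqF//.
  by rewrite -expr_div_n.
(* The prior is the odds map at 1, so comparing with it becomes comparing L^k with 1. *)
have p0E : p0 = p0 * 1 / (p0 * 1 + (1 - p0)).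
  by rewrite mulr1 subrKC divr1.
split => // [k k0|k|L1|].
- rewrite rE {1}p0E ltr_odds ?exprn_ge0//.
  by rewrite -[X in X < _](expr1n _ k) ltr_pXn2r ?nnegrE.
- rewrite !rE ltr_odds ?exprn_ge0//; split=> [|L1].
    by rewrite exprS; move: (exprn_ge0 k L0); set x := L ^+ k; nra.
  by rewrite exprS ltr_pMl// exprn_gt0// (lt_trans ltr01).
- have Li : `|L^-1| < 1.
    by rewrite ger0_norm ?invr_ge0// invf_lt1// (lt_trans ltr01).
  (* L^k diverges; dividing through by it leaves powers of 1 / L, which tend to 0. *)
  have h : p0 / (p0 + (1 - p0) * L^-1 ^+ k) @[k --> \oo] --> p0 / (p0 + (1 - p0) * 0).
    apply: cvgM; first exact: cvg_cst.
    apply: cvgV; first by rewrite mulr0 addr0 gt_eqF.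
    apply: cvgD; first exact: cvg_cst.
    by apply: cvgM; [exact: cvg_cst|exact: cvg_expr].
  rewrite mulr0 addr0 divff ?gt_eqF// in h.
  apply: cvg_trans h; apply: near_eq_cvg; apply: nearW => k.
  have Lk0 : 0 < L ^+ k by rewrite exprn_gt0// (lt_trans ltr01).
  rewrite rE exprVn; move: Lk0; set x := L ^+ k => x0; field.
  rewrite (gt_eqF x0) andbT gt_eqF//.
  by apply: addr_gt0 => //; exact: mulr_gt0.
- split=> [L1 k|L1]; first by rewrite rE L1 expr1n -p0E.
  have Lc : L ^+ k @[k --> \oo] --> (0 : R) by apply: cvg_expr; rewrite ger0_norm.
  have := odds_cvg p01 (lexx 0) Lc; rewrite mulr0 mul0r.
  by apply: cvg_trans; apply: near_eq_cvg; apply: nearW => k; rewrite rE.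
Qed.

Theorem corollary4p2 (R : realType) :
  (* conditionally independent gates: constant latent rates a (erroneous
     answer) and b (correct answer) *)
  (forall p0 a b : R, 0 < p0 < 1 -> 0 < a <= 1 -> 0 <= b <= 1 ->
     let G := constant_law a in
     let H := constant_law b in
     let r := reliability p0 G H in
     [/\ mean_LR G H = b / a,
         (forall k, (0 < k)%N -> (p0 < r k <-> 1 < mean_LR G H)),
         (forall k, (r k < r k.+1 <-> 1 < mean_LR G H)),
         (1 < mean_LR G H -> r k @[k --> \oo] --> (1 : R)) &
         (mean_LR G H = 1 -> forall k, r k = p0) /\
         (mean_LR G H < 1 -> r k @[k --> \oo] --> (0 : R))])
  /\
  (* mean likelihood ratio above one: the first gate helps *)
  (forall (p0 : R) (G H : latent_law R), 0 < p0 < 1 ->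
     on_unit G -> on_unit H -> 1 < mean_LR G H ->
     first_gate_evidence p0 G H = ln (mean_LR G H) /\
     0 < first_gate_evidence p0 G H)
  /\
  (* the tail exponents decide the eventual direction *)
  (forall (p0 : R) (G H : latent_law R) (ba bb : R), 0 < p0 < 1 ->
     on_unit G -> on_unit H -> tail_exponent G ba -> tail_exponent H bb ->
     let r := reliability p0 G H in
     let l := log_odds p0 G H in
     [/\ (bb < ba -> l k @[k --> \oo] --> +oo /\
                     \forall k \near \oo, l k < l k.+1),
         (ba = bb -> exists2 q : R, 0 < q < 1 & r k @[k --> \oo] --> q) &
         (ba < bb -> [/\ l k @[k --> \oo] --> -oo,
                         r k @[k --> \oo] --> (0 : R) &
                         \forall k \near \oo, l k.+1 < l k])])
  /\
  (* the tail exponents are logically independent of the mean ratio *)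
  (forall ba bb lam : R, 0 < ba -> 0 < bb -> 0 < lam ->
     exists G H : latent_law R,
       [/\ on_unit G, on_unit H, tail_exponent G ba, tail_exponent H bb &
           mean_LR G H = lam])
  /\
  (* the example *)
  (exists G H : latent_law R,
     [/\ is_beta_law (7 / 10) (163 / 100) G,
         is_beta_law 8 4 H,
         [/\ on_unit G, on_unit H,
             tail_exponent G (163 / 100) & tail_exponent H 4],
         [/\ `|mean G - 3 / 10| < 5 / 1000,
             `|mean H - 67 / 100| < 5 / 1000 &
             `|mean_LR G H - 22 / 10| < 5 / 100] &
         reliability (1 / 2) G H k @[k --> \oo] --> (0 : R)]).
Proof.
split; first by move=> p0 a b; exact: constant_rates.
split; first by move=> p0 G H; exact: first_gate_helps.
split.
  move=> p0 G H ba bb p01 GU HU Gb Hb r l; split.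
  - exact: tail_help.
  - by move=> e; apply: (tail_plateau p01 GU HU Gb); rewrite e.
  - exact: tail_harm.
split.
  move=> ba bb lam ba0 bb0 lam0.
  have d0 : 0 < 1 + lam by rewrite addr_gt0.
  (* The means 1 / (1 + lam) and lam / (1 + lam) lie in ]0, 1[ for every lam > 0 and have quotient
     lam. *)
  have [|G [GU Gb Gm]] := @beta_law_mean_exists R ba (1 + lam)^-1 ba0.
    by rewrite invr_gt0 d0 invf_lt1// ltrDl.
  have [|H [HU Hb Hm]] := @beta_law_mean_exists R bb (lam / (1 + lam)) bb0.
    by rewrite divr_gt0//= ltr_pdivrMr// mul1r ltrDr.
  by exists G, H; split => //; rewrite /mean_LR Gm Hm invrK divfK// gt_eqF.
have a0 : 0 < 7 / 10 :> R by lra.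
have b0 : 0 < 163 / 100 :> R by lra.
have [G GE] := beta_law_exists a0 b0.
have [H HE] := beta_law_exists (ltr0n R 8) (ltr0n R 4).
have GU := beta_law_on_unit a0 b0 GE.
have HU := beta_law_on_unit (ltr0n R 8) (ltr0n R 4) HE.
have Gb := beta_law_tail_exponent a0 b0 GE.
have Hb := beta_law_tail_exponent (ltr0n R 8) (ltr0n R 4) HE.
(* The exact means 0.7 / 2.33 and 8 / 12 have quotient 233 / 105, about 2.219. *)
have mG : mean G = 70 / 233 by rewrite (beta_law_mean a0 b0 GE); field.
have mH : mean H = 2 / 3.
  by rewrite (beta_law_mean (ltr0n R 8) (ltr0n R 4) HE); field.
exists G, H; split => //.
- rewrite /mean_LR mG mH; split; rewrite ltr_norml; lra.
(* Harm follows from 1.63 < 4 alone, although the mean ratio is well above 1. *)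
- have p01 : 0 < (1 / 2 : R) < 1 by lra.
  by have [] := tail_harm p01 GU HU Gb Hb; first by lra.
Qed.
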